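(* Let $\mathbb{K}$ be an algebraically closed field of arbitrary characteristic, let $f\in\mathbb{K}[[x,y]]$ be a nonconstant reduced power series with $f(0,0)=0$ whose Newton polygon has at least one compact edge, and let $\mathcal{T}$ be its Newton tree. Let $\mathcal{A}_0$ be the area of the (first) Newton polygon of $f$ and let $a,b$ be its traces on the $x$-axis and the $y$-axis. Let $\ell=1,\dots,s$ enumerate all Hamburger-Noether transforms performed in the construction of $\mathcal{T}$; for each $\ell$ let $X^{N_\ell}f_\ell(X,Y)$ be the resulting series, let $\mathcal{A}_\ell$ be the area of its Newton polygon limited by the line $x=N_\ell$, and let $a_\ell+N_\ell$ be its trace on the $x$-axis. Then $$-M(\mathcal{T})=2\mathcal{A}_0-a-b+\sum_{\ell=1}^{s}(2\mathcal{A}_\ell-a_\ell).$$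
   Context: **Newton polygon.** For $f=\sum c_{\alpha\beta}x^\alpha y^\beta$ the Newton polygon is the boundary of the convex hull of $\{(\alpha,\beta):c_{\alpha\beta}\neq0\}+\mathbb{R}_{\ge0}^2$. Its compact edges $S_1,\dots,S_k$ are ordered from top to bottom, $S_i$ lying on the line $p_iX+q_iY=N_i$ with $p_i,q_i\ge1$ and $\gcd(p_i,q_i)=1$. The face polynomial of $S_i$ (sum of the terms of $f$ with exponents on $S_i$) is, up to a nonzero constant, $P_i=x^{n_i}y^{m_i}\prod_{j=1}^{k_i}(x^{q_i}-\mu_{i,j}y^{p_i})^{\nu_{i,j}}$ with $\mu_{i,j}\in\mathbb{K}^*$ pairwise distinct for fixed $i$ and $\nu_{i,j}\ge1$. **Hamburger-Noether (HN) transform** for $(p_i,q_i,\mu_{i,j})$: take non-negative integers $u,v$ with $p_iv-q_iu=\varepsilon\in\{1,-1\}$ (given by the Euclidean algorithm; the choice does not affect the Newton polygons and face-exponents below) and substitute $x=X^{p_i}(Y+\bar\mu)^{u}$, $y=X^{q_i}(Y+\bar\mu)^{v}$ with $\bar\mu=\mu_{i,j}^{-\varepsilon}$. Then $f=X^{N_i}f_{i,j}(X,Y)$ with $f_{i,j}(0,Y)$ of order $\nu_{i,j}$ in $Y$; the series $f_{i,j}$ is an HN-transform. **Newton tree.** First stage: a vertical chain of vertices $v_1,\dots,v_k$ ($v_i$ for $S_i$), consecutive ones joined by an edge; $v_i$ carries the multiplicity $N_{v_i}=N_i$; the edge leaving $v_i$ upwards is decorated near $v_i$ by $q_i$, the one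 leaving downwards by $p_i$. An arrow is attached above $v_1$, decorated $(i_0)$, and one below $v_k$, decorated $(j_0)$, where $i_0,j_0\in\{0,1\}$ are the multiplicities of $x$, $y$ as factors of $f$. For every $(i,j)$: if $\nu_{i,j}=1$, attach to $v_i$ an edge ending in an undecorated arrow. If $\nu_{i,j}>1$, perform the HN transform and consider the Newton polygon of $X^{N_i}f_{i,j}(X,Y)$ (starting at $(N_i,\nu_{i,j})$), with compact edges on lines $p'_sX+q'_sY=N'_s$, $1\le s\le k'$ (top to bottom, $\gcd(p'_s,q'_s)=1$). Add a vertical chain $v'_1,\dots,v'_{k'}$ with $N_{v'_s}=N'_s$, with downward edge decorated near $v'_s$ by $p'_s$ and upward edge decorated near $v'_s$ by $q'_s+\hat p\hat q\,p'_s$, where $\hat p,\hat q$ are the final decorations at $v_i$ of its downward and upward edge; the upward edge of $v'_1$ is joined to $v_i$ (decoration $1$ near $v_i$), and an arrow decorated $(j_0')$ is attached below $v'_{k'}$, $j'_0\in\{0,1\}$ being the multiplicity of $Y$ as a factor of $f_{i,j}$. Repeat with $X^{N_i}f_{i,j}$ and the face polynomials of its Newton polygon, until all exponents $\nu$ equal $1$ (the process is finite as $f$ is reduced). **Multiplicity.** Let $\mathcal{V}$ be the set of vertices, $\mathscr{A}_0$ the set of arrows decorated $(0)$, $\delta_v$ the valency of $v$ (number of edges at $v$; it is $1$ for an arrow). If $v'\in\mathscr{A}_0$ is attached to the vertex $v$ by an edge decorated by $a$ near $v$, put $N_{v'}=N_v/a$. Then $M(\mathcal{T}):=-\sum_{v\in\mathcal{V}\cup\mathscr{A}_0}N_v(\delta_v-2)$.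 **Areas.** If the Newton polygon of $f$ meets both axes (convenient), $\mathcal{A}_0$ is the area of the region between it and the axes, and $a$ (resp. $b$) is the abscissa (resp. ordinate) of the point where it meets the $x$-axis (resp. $y$-axis). If it does not meet $x=0$ (resp. $y=0$), it is first made convenient by adding a vertex $(0,n)$ (resp. $(n,0)$) with $n$ large enough that all old vertices remain vertices of the new polygon; $2\mathcal{A}_0-a-b$ does not depend on the choice. Likewise, for $X^{N_\ell}f_\ell$, $\mathcal{A}_\ell$ is the area of the region bounded by the lines $x=N_\ell$, $y=0$ and the Newton polygon, and $a_\ell+N_\ell$ is the abscissa of the point where it meets the $x$-axis; if it does not meet $y=0$ one first adds a vertex $(n,0)$ with $n$ large in the same way, and $2\mathcal{A}_\ell-a_\ell$ does not depend on the choice. *)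

(* Defs.v *)
From HB Require Import structures.
From mathcomp Require Import all_boot all_order all_algebra.
From mathcomp Require Import all_classical all_reals all_analysis.
Set Implicit Arguments.
Unset Strict Implicit.
Unset Printing Implicit Defensive.
Import Order.TTheory GRing.Theory Num.Theory.
Import numFieldNormedType.Exports.
Local Open Scope classical_set_scope.
Local Open Scope ring_scope.

Section PowerSeries.
Variable K : fieldType.

(* An element of K[[x, y]]: f i j is the coefficient of x^i y^j; equality of
   series is =2. *)
Definition fps2 := nat -> nat -> K.

Definition psmon (i j : nat) : fps2 :=
  fun a b => ((a == i) && (b == j))%:R.

Definition psmul (f g : fps2) : fps2 := fun i j =>
  \sum_(a < i.+1) \sum_(b < j.+1) f a b * g (i - a)%N (j - b)%N.

Definition psdvd (d f : fps2) : Prop := exists h, f =2 psmul d h.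

Definition psunit (g : fps2) : Prop := psdvd g (psmon 0 0).

(* Only meant for nonzero f. *)
Definition psreduced (f : fps2) : Prop :=
  forall g, psdvd (psmul g g) f -> psunit g.

Definition xmult (f : fps2) (i : nat) : Prop :=
  psdvd (psmon i 0) f /\ ~ psdvd (psmon i.+1 0) f.

Definition ymult (f : fps2) (j : nat) : Prop :=
  psdvd (psmon 0 j) f /\ ~ psdvd (psmon 0 j.+1) f.

Definition exponents (f : fps2) : set (nat * nat) :=
  [set ab | f ab.1 ab.2 != 0].

(* The face polynomial of f on pX + qY = N is
   c x^n y^m \prod_(mu, nu) (x^q - mu y^p)^nu, where ms lists the pairs
   (mu, nu). In {poly {poly K}} the outer variable 'X is x and the inner one
   'X%:P is y, so P`_a`_b is the coefficient of x^a y^b. *)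
Definition face_roots (f : fps2) (p q N : nat) (ms : seq (K * nat)) : Prop :=
  [/\ uniq [seq r.1 | r <- ms],
      forall r, r \in ms -> r.1 != 0 /\ (0 < r.2)%N &
      exists (c : K) (n m : nat), c != 0 /\
        let P : {poly {poly K}} :=
          c%:P%:P * 'X^n * 'X%:P ^+ m *
            \prod_(r <- ms) ('X^q - r.1%:P%:P * 'X%:P ^+ p) ^+ r.2 in
        forall a b,
          P`_a`_b = if (p * a + q * b)%N == N then f a b else 0].

(* The series f(X^p (Y + m)^u, X^q (Y + m)^v). For p, q > 0 each coefficient
   is a finite sum: p a + q b = i forces a, b <= i. *)
Definition hn_subst (f : fps2) (p q u v : nat) (m : K) : fps2 :=
  fun i j => \sum_(a < i.+1) \sum_(b < i.+1 | (p * a + q * b)%N == i)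
    f a b * (('X + m%:P) ^+ (u * a + v * b))`_j.

(* p v - q u = eps = 1, resp. -1; the third component is mu ^ (- eps). *)
Definition hn_params (p q : nat) (mu : K) (u v : nat) (m : K) : Prop :=
  ((p * v = q * u + 1)%N /\ m = mu^-1) \/ ((q * u = p * v + 1)%N /\ m = mu).

(* h is an HN-transform of f: the substitution turns f into X^N h. *)
Definition hn_transform (f : fps2) (p q N : nat) (mu : K) (h : fps2) :
    Prop :=
  exists (u v : nat) (m : K), hn_params p q mu u v m /\
    hn_subst f p q u v m =2 psmul (psmon N 0) h.

End PowerSeries.

Section NewtonPolygon.
Variable R : realType.

Definition convex_hull (A : set (R^o * R^o)) : set (R^o * R^o) :=
  [set z | forall C : set (convex_lmodType (R^o * R^o)%type),
             convex_set C -> A `<=` C -> C z].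

Definition newton_polyhedron (S : set (nat * nat)) : set (R^o * R^o) :=
  convex_hull [set z | exists2 ab, S ab & ab.1%:R <= z.1 /\ ab.2%:R <= z.2].

Definition face (S : set (nat * nat)) (p q N : nat) : set (R^o * R^o) :=
  [set z | newton_polyhedron S z /\ p%:R * z.1 + q%:R * z.2 = N%:R].

(* (p, q, N) stands for the line pX + qY = N; the edges with p, q > 0 are the
   compact ones. *)
Definition compact_edge (S : set (nat * nat)) (p q N : nat) : Prop :=
  [/\ (0 < p)%N, (0 < q)%N, coprime p q,
      forall z, newton_polyhedron S z -> N%:R <= p%:R * z.1 + q%:R * z.2 &
      exists z1 z2, [/\ face S p q N z1, face S p q N z2 & z1 <> z2]].

Definition compact_edges (S : set (nat * nat)) (es : seq (nat * nat * nat)) :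
    Prop :=
  [/\ uniq es,
      forall p q N, (p, q, N) \in es <-> compact_edge S p q N &
      (* from top to bottom *)
      forall i j, (i < j < size es)%N ->
        let: (p, q, N) := nth (0, 0, 0)%N es i in
        let: (p', q', N') := nth (0, 0, 0)%N es j in
        forall z z', face S p q N z -> face S p' q' N' z' -> z'.2 <= z.2].

Definition newton_vertex (S : set (nat * nat)) (z : R^o * R^o) : Prop :=
  newton_polyhedron S z /\
  forall z1 z2 (t : R),
    newton_polyhedron S z1 -> newton_polyhedron S z2 -> 0 < t < 1 ->
    z = t *: z1 + (1 - t) *: z2 -> z1 = z2.

Definition meets_xaxis (S : set (nat * nat)) : Prop :=
  exists t, newton_polyhedron S (t, 0).

Definition meets_yaxis (S : set (nat * nat)) : Prop :=
  exists t, newton_polyhedron S (0, t).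

Definition adds_vertex (S : set (nat * nat)) (v : nat * nat)
    (S' : set (nat * nat)) : Prop :=
  S' = S `|` [set v] /\ newton_vertex S `<=` newton_vertex S'.

Definition complete_x (S S' : set (nat * nat)) : Prop :=
  (meets_xaxis S /\ S' = S) \/
  (~ meets_xaxis S /\ exists n, adds_vertex S (n, 0)%N S').

Definition complete_y (S S' : set (nat * nat)) : Prop :=
  (meets_yaxis S /\ S' = S) \/
  (~ meets_yaxis S /\ exists n, adds_vertex S (0, n)%N S').

Definition x_trace (S : set (nat * nat)) (a : R) : Prop :=
  newton_polyhedron S (a, 0) /\
  forall t, newton_polyhedron S (t, 0) -> a <= t.

Definition y_trace (S : set (nat * nat)) (b : R) : Prop :=
  newton_polyhedron S (0, b) /\
  forall t, newton_polyhedron S (0, t) -> b <= t.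

(* The area of the region bounded by x = N, y = 0 and the Newton polygon. *)
Definition newton_area (S : set (nat * nat)) (N : nat) : \bar R :=
  ((@lebesgue_measure R) \x (@lebesgue_measure R))%E
    [set z | [/\ N%:R <= z.1, 0 <= z.2 & ~ newton_polyhedron S z]].

(* Area and traces depend on the chosen completion when S misses an axis. *)
Definition first_area (S : set (nat * nat)) (A a b : R) : Prop :=
  exists S1 S2, [/\ complete_y S S1, complete_x S1 S2,
    newton_area S2 0 = A%:E, x_trace S2 a & y_trace S2 b].

Definition hn_area (S : set (nat * nat)) (N : nat) (A a : R) : Prop :=
  exists S1, [/\ complete_x S S1, newton_area S1 N = A%:E
    & x_trace S1 (a + N%:R)].

End NewtonPolygon.

(* Vertex N is a vertex of multiplicity N; Arrow None is an undecorated arrow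
   and Arrow (Some j) an arrow decorated (j), j in {0, 1}. *)
Inductive nlabel := Vertex of nat | Arrow of option bool.

(* Trees are rooted at the top arrow. A child (d, d', t) of a node is an edge
   to the root of t, decorated by d near the node and by d' near that root. *)
Inductive ntree :=
  Node of nlabel & seq (option nat * option nat * ntree).

Definition root_label (t : ntree) : nlabel := let: Node l _ := t in l.

(* All nodes of a tree, each with its star, i.e. one pair for each edge at the
   node: the label of the neighbour and the decoration of the edge near this
   neighbour. The first argument is the edge to the parent, if any. *)
Fixpoint nodes (up : seq (nlabel * option nat)) (t : ntree) :
    seq (nlabel * seq (nlabel * option nat)) :=
  let: Node l es := t in
  (l, up ++ [seq (root_label e.2, e.1.2) | e <- es]) ::
  flatten [seq nodes [:: (l, e.1.1)] e.2 | e <- es].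

Section Multiplicity.
Variable R : realType.

Definition in_V_A0 (x : nlabel * seq (nlabel * option nat)) : bool :=
  match x.1 with
  | Vertex _ => true
  | Arrow d => d == Some false
  end.

Definition valency (x : nlabel * seq (nlabel * option nat)) : nat := size x.2.

Definition node_mult (x : nlabel * seq (nlabel * option nat)) : R :=
  match x with
  | (Vertex N, _) => N%:R
  | (Arrow _, [:: (Vertex N, Some a)]) => N%:R / a%:R
  | _ => 0
  end.

Definition tree_mult (t : ntree) : R :=
  - \sum_(x <- nodes [::] t | in_V_A0 x)
      node_mult x * ((valency x)%:R - 2).

End Multiplicity.

Section NewtonTree.
Variables (R : realType) (K : fieldType).
Notation fps2 := (fps2 K).

(* Decoration of the upward edge near the first vertex of the chain for es;
   None if there is no vertex left, the edge then ending at the bottom arrow. *)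
Definition up_decoration (c : nat) (es : seq (nat * nat * nat)) : option nat :=
  if es is (p, q, _) :: _ then Some (q + c * p)%N else None.

(* chain g c j es t L: the vertical chain of the edges es of the Newton polygon
   of g, with everything attached to it, and ending with the arrow (j), is t.
   Here c is the product of the two decorations at the vertex to which the
   chain is joined; c = 0 for the first chain, whose upward decorations are
   the q_i themselves. L lists, as pairs (N, h), the HN-transforms X^N h
   performed along the way.
   branches g p q N c ms bs L: bs are the edges attached to the vertex of the
   edge (p, q, N) of g for the pairs (mu, nu) in ms, where c is the product of
   the two decorations at this vertex. *)
Inductive chain : fps2 -> nat -> bool -> seq (nat * nat * nat) ->
    ntree -> seq (nat * fps2) -> Prop :=
| ChainEnd g c j : chain g c j [::] (Node (Arrow (Some j)) [::]) [::]
| ChainVertex g c j p q N es t L ms bs Lb :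
    face_roots g p q N ms ->
    branches g p q N (p * (q + c * p)) ms bs Lb ->
    chain g c j es t L ->
    chain g c j ((p, q, N) :: es)
      (Node (Vertex N) ((Some p, up_decoration c es, t) :: bs)) (Lb ++ L)
with branches : fps2 -> nat -> nat -> nat -> nat -> seq (K * nat) ->
    seq (option nat * option nat * ntree) -> seq (nat * fps2) -> Prop :=
| BranchesNil g p q N c : branches g p q N c [::] [::] [::]
| BranchesArrow g p q N c mu ms bs L :
    branches g p q N c ms bs L ->
    branches g p q N c ((mu, 1%N) :: ms)
      ((None, None, Node (Arrow None) [::]) :: bs) L
| BranchesHN g p q N c mu nu ms bs L h (j : bool) es t Lh :
    (1 < nu)%N ->
    hn_transform g p q N mu h ->
    compact_edges R (exponents (psmul (psmon K N 0) h)) es ->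
    es <> [::] ->
    ymult h j ->
    chain (psmul (psmon K N 0) h) c j es t Lh ->
    branches g p q N c ms bs L ->
    branches g p q N c ((mu, nu) :: ms)
      ((Some 1%N, up_decoration c es, t) :: bs) ((N, h) :: Lh ++ L).

(* T is the Newton tree of f and L lists the HN-transforms (N, h) performed in
   its construction. *)
Definition newton_tree (f : fps2) (T : ntree) (L : seq (nat * fps2)) :
    Prop :=
  exists (i j : bool) (es : seq (nat * nat * nat)) (t : ntree),
    [/\ xmult f i, ymult f j, compact_edges R (exponents f) es /\ es <> [::],
        chain f 0 j es t L
      & T = Node (Arrow (Some i)) [:: (None, up_decoration 0 es, t)]].

End NewtonTree.

(* Main.v *)
From HB Require Import structures.
From Stdlib Require List.
Require Import Defs.
From mathcomp Require Import all_boot all_order all_algebra.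
From mathcomp Require Import all_classical all_reals all_analysis.
From mathcomp Require Import measurable_realfun ring lra zify.
Set Implicit Arguments.
Unset Strict Implicit.
Unset Printing Implicit Defensive.
Import Order.TTheory GRing.Theory Num.Theory.
Import numFieldNormedType.Exports.
Local Open Scope ring_scope.

(** Both sides are sums over all the edges of all the Newton polygons met in
    the construction. Let an edge lie on [pX + qY = N] and have lattice length
    [l], so that its end points differ by [(q l, - p l)].

    The triangle spanned by the origin and this edge has doubled area [l N].
    Hence a polygon which starts at [(N0, b0)] and ends on the x-axis has, to
    the right of [x = N0], the doubled area [\sum l N - N0 b0]; this is
    [newton_area_path], where the region is cut into vertical trapezoids.

    On the tree side, the vertex of the edge has valency 2 plus the number [r]
    of roots of its face polynomial, hence it contributes [r N]. The length [l]
    is the sum of the exponents [nu] of these roots ([face_roots_length]), so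
    [r N] differs from [l N] by the sum of the [(nu - 1) N]. This is what the
    HN-transforms account for: the one at a root with exponent [nu] has a
    polygon which starts at [(N, nu)] ([hn_order]), so that cutting its area at
    [x = N] subtracts [nu N], and measuring its trace from [x = N] gives back
    [N]. The roots with [nu = 1] need no correction.

    The traces are the multiplicities of the arrows (0): if the last edge ends
    at [(a', 0)] then [N = p a'], and if the first one starts at [(0, b)] then
    [N = q b]. When the polygon misses an axis it stays at distance 1 from it,
    so that an added vertex at distance [n] from the origin brings one edge with
    [l N = n], and the trace on that axis is [n] too: the two cancel.

    The definitions speak of the convex hull of an infinite set, whereas the
    argument walks along the polygon. The two are related by [newton_path],
    the lower left boundary described edge by edge: it exists
    ([newton_path_exists]), the list of compact edges has to be the list of its
    edges ([compact_edgesE]), and completing the polygon on an axis prolongs it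
    by one edge ([complete_x_path], [complete_y_path]). The theorem follows by
    induction on the tree ([chain_sum]). *)

(** * The boundary of a Newton polygon as a lattice path *)

Section NewtonPath.
Local Open Scope nat_scope.
Local Open Scope classical_set_scope.

Lemma nat_prop_min (P : nat -> Prop) :
  (exists n, P n) -> exists2 n, P n & forall m, P m -> n <= m.
Proof.
case=> n Pn; have exP : exists n, `[< P n >] by exists n; apply/asboolP.
case: (ex_minnP exP) => m /asboolP Pm mP; exists m => // k Pk.
by apply: mP; apply/asboolP.
Qed.

Definition supports (S : set (nat * nat)) (p q a b : nat) : Prop :=
  forall s, S s -> p * a + q * b <= p * s.1 + q * s.2.

(** The path descends along the edges from [(a, b)] to [(a', b')]. The last
    index sums [l N] over the edges, which is twice the area of the triangles
    they span with the origin. Confining the points of [S] on a line to the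
    range of [x] between its two ends makes every step a whole edge; this is
    what makes the slopes strictly monotone along the path. *)
Inductive newton_path (S : set (nat * nat)) :
    nat -> nat -> seq (nat * nat * nat) -> nat -> nat -> nat -> Prop :=
| PathEnd a b : S (a, b) -> (forall s, S s -> b <= s.2) ->
    newton_path S a b [::] a b 0
| PathStep a b p q l es a' b' D :
    0 < p -> 0 < q -> 0 < l -> coprime p q -> S (a, b + p * l) ->
    supports S p q a (b + p * l) ->
    (forall s, S s -> p * s.1 + q * s.2 = p * a + q * (b + p * l) ->
       a <= s.1 <= a + q * l) ->
    newton_path S (a + q * l) b es a' b' D ->
    newton_path S a (b + p * l) ((p, q, p * a + q * (b + p * l)) :: es)
      a' b' (l * (p * a + q * (b + p * l)) + D).

Lemma newton_path_start S a b es a' b' D :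
  newton_path S a b es a' b' D -> S (a, b).
Proof. by case. Qed.

Lemma newton_path_end S a b es a' b' D :
  newton_path S a b es a' b' D -> S (a', b') /\ forall s, S s -> b' <= s.2.
Proof. by elim. Qed.

Lemma newton_path_cons S a b p q N es a' b' D :
  newton_path S a b ((p, q, N) :: es) a' b' D ->
  exists l b1 D1,
    [/\ [/\ b = b1 + p * l, N = p * a + q * b & D = l * N + D1],
        [/\ 0 < p, 0 < q, 0 < l & coprime p q],
        supports S p q a b,
        forall s, S s -> p * s.1 + q * s.2 = p * a + q * b ->
          a <= s.1 <= a + q * l
      & newton_path S (a + q * l) b1 es a' b' D1].
Proof.
move=> P; inversion P; subst.
by eexists; eexists; eexists; split; last by eassumption.
Qed.

Lemma newton_path_nil S a b a' b' D :
  newton_path S a b [::] a' b' D -> [/\ a' = a, b' = b & D = 0].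
Proof. by move=> P; inversion P. Qed.

(** The next edge goes to a point minimising [(s.1 - a) / (b - s.2)] below
    height [b], and to the lowest such point. The normal [(p0, q0)] stands for
    the preceding edge, or is [(1, 0)] at the start: it keeps the points to the
    left of [(a, b)] above the line of the new edge. *)
Lemma newton_path_exists S p0 q0 a b :
  0 < p0 -> S (a, b) -> supports S p0 q0 a b ->
  (forall s, S s -> p0 * s.1 + q0 * s.2 = p0 * a + q0 * b -> b <= s.2) ->
  exists es a' b' D, newton_path S a b es a' b' D.
Proof.
elim/ltn_ind: b p0 q0 a => b IH p0 q0 a p0gt0 Sab sup supE.
have [bmin|] := pselect (forall s, S s -> b <= s.2).
  by exists [::], a, b, 0; apply: PathEnd.
move/existsNP => [s0 /not_implyP [Ss0 /negP]]; rewrite -ltnNge => s0b.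
have right s : S s -> s.2 < b -> a < s.1.
  move=> Ss sb; have := sup s Ss; have := supE s Ss; nia.
(* b - s.2 divides b!, so the quotient scaled by b! is a natural number; the
   weight w s * b.+1 + s.2 orders first by quotient and then by height. *)
pose w (s : nat * nat) := (s.1 - a) * (b`! %/ (b - s.2)).
have wE s : s.2 < b -> w s * (b - s.2) = (s.1 - a) * b`!.
  move=> sb; rewrite /w -mulnA divnK // dvdn_fact //; lia.
have [|k] := @nat_prop_min
    (fun k => exists s, [/\ S s, s.2 < b & k = w s * b.+1 + s.2]).
  by exists (w s0 * b.+1 + s0.2), s0.
case=> -[x y] [/= Sxy yb ->] kmin.
have ax := right _ Sxy yb; rewrite /= in ax.
have b0 := fact_gt0 b.
have slope s : S s -> s.2 < b -> (x - a) * (b - s.2) <= (s.1 - a) * (b - y) /\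
   ((x - a) * (b - s.2) = (s.1 - a) * (b - y) -> y <= s.2).
  move=> Ss sb.
  have := kmin (w s * b.+1 + s.2).
  move/(_ (ex_intro _ s (And3 Ss sb erefl))) => le.
  have /= h1 := wE _ sb; have /= h2 := wE (x, y) yb.
  have wle : w (x, y) <= w s by nia.
  split.
    rewrite -(leq_pmul2r b0).
    have -> : (x - a) * (b - s.2) * b`! = w (x, y) * (b - y) * (b - s.2) by nia.
    have -> : (s.1 - a) * (b - y) * b`! = w s * (b - y) * (b - s.2) by nia.
    by rewrite leq_mul2r leq_mul2r wle !orbT.
  move=> E; have wE' : w (x, y) = w s.
    have : w (x, y) * ((b - y) * (b - s.2)) = w s * ((b - y) * (b - s.2)).
      by nia.
    move/eqP; rewrite eqn_pmul2r; last by rewrite muln_gt0 !subn_gt0 yb sb.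
    by move/eqP.
  by move: le; rewrite wE' leq_add2l.
pose l := gcdn (b - y) (x - a).
have l0 : 0 < l by rewrite gcdn_gt0 subn_gt0 yb.
pose p := (b - y) %/ l; pose q := (x - a) %/ l.
have pl : p * l = b - y by rewrite /p divnK // dvdn_gcdl.
have ql : q * l = x - a by rewrite /q divnK // dvdn_gcdr.
have cpq : coprime p q.
  have := muln_gcdl p q l; rewrite pl ql -/l.
  by move/eqP; rewrite -{2}[l]mul1n eqn_pmul2r.
have p0' : 0 < p by nia.
have q0' : 0 < q by nia.
have bE : b = y + p * l by lia.
have xE : x = a + q * l by lia.
have side s : S s -> b <= s.2 -> s.1 < a ->
    p * a + q * b < p * s.1 + q * s.2.
  move=> Ss bs sa; have h1 := sup s Ss; have h2 := sup _ Sxy.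
  have h3 := supE _ Sxy; rewrite /= in h2 h3.
  have h4 : q0 * p < p0 * q by nia.
  have : p0 * (a - s.1) <= q0 * (s.2 - b) by nia.
  have ->: p * a + q * b < p * s.1 + q * s.2 = (p * (a - s.1) < q * (s.2 - b)).
    by nia.
  nia.
have nsup s : S s -> p * a + q * b <= p * s.1 + q * s.2.
  move=> Ss; case: (ltnP s.2 b) => sb; last first.
    by case: (ltnP s.1 a) => sa; [apply/ltnW/side | nia].
  have as_ := right _ Ss sb; have [+ _] := slope s Ss sb.
  rewrite -pl -ql => h.
  have h' : q * (b - s.2) <= (s.1 - a) * p by nia.
  nia.
have nsupE s : S s -> p * s.1 + q * s.2 = p * a + q * b -> a <= s.1 <= x.
  move=> Ss E; case: (ltnP s.2 b) => sb; last first.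
    case: (ltnP s.1 a) => sa; [have := side _ Ss sb sa; lia | nia].
  have as_ := right _ Ss sb; have [_] := slope s Ss sb.
  rewrite -pl -ql => h.
  have h' : q * (b - s.2) = (s.1 - a) * p by nia.
  have : y <= s.2 by apply: h; nia.
  nia.
have [|||es [a' [b' [D P]]]] := IH y yb p q x p0'.
- by [].
- by move=> s /nsup; rewrite bE xE; nia.
- by move=> s Ss E; have := nsupE s Ss; nia.
exists ((p, q, p * a + q * b) :: es), a', b', (l * (p * a + q * b) + D).
rewrite bE; apply: PathStep => //; rewrite -?bE -?xE //.
Qed.

End NewtonPath.

(** * Paths and compact edges *)

Section NewtonPolyhedron.
Local Open Scope classical_set_scope.
Variable R : realType.
Implicit Type S : set (nat * nat).
Local Notation polyhedron := (@newton_polyhedron R).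

Lemma polyhedron_gen S a b (z : R^o * R^o) :
  S (a, b) -> a%:R <= z.1 -> b%:R <= z.2 -> polyhedron S z.
Proof. by move=> Sab az bz C _; apply; exists (a, b). Qed.

Lemma polyhedron_point S a b : S (a, b) -> polyhedron S (a%:R, b%:R).
Proof. by move=> Sab; apply: polyhedron_gen Sab _ _ => /=. Qed.

Lemma polyhedron_segment S (z1 z2 : R^o * R^o) (t : R) :
  polyhedron S z1 -> polyhedron S z2 -> 0 <= t <= 1 ->
  polyhedron S (t *: z1 + (1 - t) *: z2).
Proof.
move=> Sz1 Sz2 /andP[t0 t1] C Ccvx sub.
have := Ccvx z1 z2 (@Itv01 R t t0 t1).
by rewrite !inE; apply; [apply: Sz1 | apply: Sz2].
Qed.

Lemma polyhedron_halfplane S (u v c : R) (z : R^o * R^o) :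
  0 <= u -> 0 <= v ->
  (forall s, S s -> c <= u * s.1%:R + v * s.2%:R) ->
  polyhedron S z -> c <= u * z.1 + v * z.2.
Proof.
move=> u0 v0 Sc Pz.
apply: (Pz [set w | c <= u * w.1 + v * w.2]).
- move=> x y t; rewrite !inE /= => cx cy.
  have t0 : 0 <= t%:num by [].
  have t1 : t%:num <= 1 by [].
  case: x y cx cy => [x1 x2] [y1 y2] /= cx cy.
  change (c <= u * (t%:num * x1 + (1 - t%:num) * y1)
             + v * (t%:num * x2 + (1 - t%:num) * y2)).
  have : t%:num * c <= t%:num * (u * x1 + v * x2) by rewrite ler_wpM2l.
  have : (1 - t%:num) * c <= (1 - t%:num) * (u * y1 + v * y2).
    by rewrite ler_wpM2l // subr_ge0.
  lra.
- move=> x [s Ss [h1 h2]] /=; apply: le_trans (Sc s Ss) _.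
  by rewrite lerD // ler_wpM2l.
Qed.

Lemma polyhedron_support S (p q N : nat) (z : R^o * R^o) :
  (forall s, S s -> (N <= p * s.1 + q * s.2)%N) ->
  polyhedron S z -> N%:R <= p%:R * z.1 + q%:R * z.2.
Proof.
move=> sup; apply: polyhedron_halfplane => // s /sup.
by rewrite -!natrM -natrD ler_nat.
Qed.

Lemma supports_polyhedron S p q a b (z : R^o * R^o) : supports S p q a b ->
  polyhedron S z -> 0 <= p%:R * (z.1 - a%:R) + q%:R * (z.2 - b%:R).
Proof. by move=> /polyhedron_support h /h; rewrite natrD !natrM; lra. Qed.

(** A normal strictly between two normals which are both minimal at [(a, b)] is
    a positive combination of them, so it is minimal at that point only. *)
Lemma no_edge_between S a b p0 q0 p1 q1 p q N :
  S (a, b) -> supports S p0 q0 a b -> supports S p1 q1 a b ->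
  (p * q0 < p0 * q)%N -> (p1 * q < p * q1)%N -> ~ compact_edge R S p q N.
Proof.
move=> Sab sup0 sup1 lt0 lt1 [p_gt0 q_gt0 _ supN [z1 [z2 [f1 f2]]]].
have onface z : @face R S p q N z -> z = (a%:R, b%:R).
  case=> Pz zN; have h0 := supports_polyhedron sup0 Pz.
  have h1 := supports_polyhedron sup1 Pz.
  have := supN _ (polyhedron_point Sab); rewrite /= -zN => h.
  have hp : (0:R) < p%:R by rewrite ltr0n.
  have hq : (0:R) < q%:R by rewrite ltr0n.
  have d0 : p%:R * q0%:R < p0%:R * q%:R :> R by rewrite -!natrM ltr_nat.
  have d1 : p1%:R * q%:R < p%:R * q1%:R :> R by rewrite -!natrM ltr_nat.
  have p0_ge0 : (0:R) <= p0%:R by []. have q0_ge0 : (0:R) <= q0%:R by [].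
  have p1_ge0 : (0:R) <= p1%:R by []. have q1_ge0 : (0:R) <= q1%:R by [].
  case: z {Pz zN} h0 h1 h => x y /= h0 h1 h.
  have [X hX] : exists X, X = x - a%:R by exists (x - a%:R).
  have [Y hY] : exists Y, Y = y - b%:R by exists (y - b%:R).
  rewrite -hX -hY in h0 h1.
  have {}h : p%:R * X + q%:R * Y <= 0 by rewrite hX hY; lra.
  have X0 : X = 0.
    have i1 : 0 <= (p0%:R * q%:R - p%:R * q0%:R) * X by nra.
    have i2 : 0 <= (p1%:R * q%:R - p%:R * q1%:R) * X by nra.
    have : 0 <= X by move: i1; rewrite pmulr_rge0 // subr_gt0.
    have : X <= 0 by move: i2; rewrite nmulr_rge0 // subr_lt0.
    lra.
  have Y0 : Y = 0.
    have i1 : 0 <= (p%:R * q0%:R - p0%:R * q%:R) * Y by nra.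
    have i2 : 0 <= (p%:R * q1%:R - p1%:R * q%:R) * Y by nra.
    have : 0 <= Y by move: i2; rewrite pmulr_rge0 // subr_gt0.
    have : Y <= 0 by move: i1; rewrite nmulr_rge0 // subr_lt0.
    lra.
  by congr pair; lra.
by apply; rewrite (onface _ f1) (onface _ f2).
Qed.

(** The far end of the second edge is beyond the end of the first one, hence
    strictly above the line of the first one. *)
Lemma newton_path_slope S a b p q l p' q' N' es a' b' D :
  (0 < l)%N -> (0 < p)%N -> (0 < q)%N ->
  supports S p q a (b + p * l) ->
  (forall s, S s -> p * s.1 + q * s.2 = p * a + q * (b + p * l) ->
       a <= s.1 <= a + q * l)%N ->
  newton_path S (a + q * l) b ((p', q', N') :: es) a' b' D ->
  (p' * q < p * q')%N.
Proof.
move=> l0 p0 q0 sup supE.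
move=> /newton_path_cons[l' [b1 [D1 [[bE _ _] [p0' q0' l0' _] _ _]]]].
move=> /newton_path_start Sx.
have := sup _ Sx; have := supE _ Sx; rewrite /= bE; nia.
Qed.

Lemma newton_path_edge S a b es a' b' D p q N :
  newton_path S a b es a' b' D -> (p, q, N) \in es -> compact_edge R S p q N.
Proof.
elim=> // {a b es a' b' D}.
move=> a b p1 q1 l es a' b' D p0 q0 l0 cop Sab sup supE P IH.
rewrite inE => /orP[/eqP[-> -> ->]|/IH //].
split=> //; first by move=> z; apply: polyhedron_support.
exists (a%:R, (b + p1 * l)%:R), ((a + q1 * l)%:R, b%:R); split.
- split; first exact: polyhedron_point Sab.
  by rewrite /= -!natrM -natrD.
- split; first by apply: polyhedron_point; exact: newton_path_start P.
  by rewrite /= -!natrM -natrD; congr _%:R; lia.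
- case=> /eqP; rewrite eqr_nat => /eqP; nia.
Qed.

(** Compare the edge with the next step of the path. If it is less steep it
    comes later; if it is steeper it is caught between the preceding normal
    [(p0, q0)] and that of the step, which [no_edge_between] excludes. At the
    end of the path the normal of the step is replaced by [(0, 1)]. *)
Lemma edge_in_newton_path S a b es a' b' D p0 q0 p q N :
  newton_path S a b es a' b' D -> supports S p0 q0 a b ->
  (p * q0 < p0 * q)%N -> compact_edge R S p q N -> (p, q, N) \in es.
Proof.
move=> P; elim: P p0 q0 => {a b es a' b' D} [a b Sab bmin|].
  move=> p0 q0 sup0 lt E; have := E; case=> p_gt0 _ _ _ _.
  exfalso; move: E; apply: (@no_edge_between S a b p0 q0 0 1) => //.
    by move=> s /bmin /=; lia.
  by rewrite muln1.
move=> a b p1 q1 l es a' b' D p1_gt0 q1_gt0 l0 cop Sab sup supE P IH.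
move=> p0 q0 sup0 lt E.
rewrite inE; case: (ltngtP (p1 * q) (p * q1))%N => c; last first.
- apply/orP; left; case: (E) => p_gt0 q_gt0 copE supN [z1 [_ [[Pz1 z1N] _ _]]].
  have pp : p1 = p.
    apply/eqP; rewrite eqn_dvd; apply/andP; split.
      by rewrite -(@Gauss_dvdl p1 p q1) // -c dvdn_mulr.
    by rewrite -(@Gauss_dvdl p p1 q) // c dvdn_mulr.
  subst p1; have qq : q1 = q by nia.
  subst q1; apply/eqP; congr (_, _, _); apply/eqP; rewrite -(eqr_nat R).
  rewrite eq_le; apply/andP; split.
    by have := supN _ (polyhedron_point Sab); rewrite /= -!natrM -natrD.
  by rewrite -z1N; apply: polyhedron_support Pz1.
- apply/orP; right; apply: (IH p1 q1) => // s Ss.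
  by have := sup s Ss; lia.
- by exfalso; move: E; apply: no_edge_between Sab sup0 sup lt c.
Qed.

(** Cross products would be a transitive relation for positive [q] only. *)
Definition steeper (e e' : nat * nat * nat) : bool :=
  (e'.1.1%:R / e'.1.2%:R : rat) < e.1.1%:R / e.1.2%:R.

Lemma steeperE p q N p' q' N' : (0 < q)%N -> (0 < q')%N ->
  steeper (p, q, N) (p', q', N') = (p' * q < p * q')%N.
Proof.
move=> q0 q0'; rewrite /steeper /= ltr_pdivrMr ?ltr0n // mulrAC.
by rewrite ltr_pdivlMr ?ltr0n // -!natrM ltr_nat.
Qed.

Lemma newton_path_sorted S a b es a' b' D :
  newton_path S a b es a' b' D -> sorted steeper es.
Proof.
elim=> // {a b es a' b' D} a b p q l [|[[p' q'] N'] es] a' b' D //.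
move=> p0 q0 l0 cop Sab sup supE P IH /=; apply/andP; split=> //.
rewrite steeperE //; last by have [? [? [? [_ []]]]] := newton_path_cons P.
exact: newton_path_slope P.
Qed.

(** Each of two edges lies above the line of the other one. Applied to the upper
    end of the upper edge and to the lower end of the lower edge, this compares
    the slopes; they differ, since coprime normals with equal slopes are equal
    and have the same minimum. *)
Lemma compact_edges_sorted S es : compact_edges R S es -> sorted steeper es.
Proof.
case=> ues mem ord; apply: pairwise_sorted; apply/(pairwiseP (0, 0, 0)%N).
move=> i j; rewrite !inE => isz jsz ij.
have := ord i j; rewrite ij jsz => /(_ isT).
have := mem_nth (0, 0, 0)%N isz; have := mem_nth (0, 0, 0)%N jsz.
have : nth (0, 0, 0)%N es i <> nth (0, 0, 0)%N es j.
  by move/eqP; rewrite nth_uniq // => /eqP eij; rewrite eij ltnn in ij.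
case: (nth _ es i) => [[p q] N]; case: (nth _ es j) => [[p' q'] N'].
move=> ne /mem E' /mem E {}ord.
case: (E) => p0 q0 cop sup [z1 [z2 [f1 f2 z12]]].
case: (E') => p0' q0' cop' sup' [w1 [w2 [g1 g2 w12]]].
rewrite steeperE //.
have hp : (0:R) < p%:R by rewrite ltr0n.
have hq : (0:R) < q%:R by rewrite ltr0n.
have hp' : (0:R) < p'%:R by rewrite ltr0n.
have hq' : (0:R) < q'%:R by rewrite ltr0n.
(* As p > 0, distinct points of a line pX + qY = N have distinct heights. *)
have two (m n M : nat) (x1 x2 : R^o * R^o) : (0 < m)%N -> x1 <> x2 ->
  @face R S m n M x1 -> @face R S m n M x2 -> exists x x' : R^o * R^o,
    [/\ @face R S m n M x, @face R S m n M x' & x'.2 < x.2].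
  move=> m0 x12 e1 e2.
  case: (ltgtP x1.2 x2.2) => c; [by exists x2, x1 | by exists x1, x2 |].
  case: x12; case: e1 e2 => _ + [_].
  case: x1 c => x1 y1; case: x2 => x2 y2 /= -> <- /eqP.
  rewrite -subr_eq0 -addrA opprD [X in _ + X]addrCA subrr addr0 -mulrBr mulf_eq0.
  by rewrite pnatr_eq0 -leqn0 leqNgt m0 /= subr_eq0 => /eqP ->.
have [{z12}u1 [u2 [{}f1 {}f2 u12]]] := two _ _ _ _ _ p0 z12 f1 f2.
have [{w12}v1 [v2 [{}g1 {}g2 v12]]] := two _ _ _ _ _ p0' w12 g1 g2.
have o := ord _ _ f2 g1.
case: f1 g2 f2 g1 => Pu1 eu1 [Pv2 ev2] [Pu2 eu2] [Pv1 ev1].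
have i1 := sup _ Pv2; have i2 := sup' _ Pu1.
have D0 : 0 < u1.2 - v2.2 by lra.
have le : p'%:R * q%:R <= p%:R * q'%:R :> R.
  have j1 : q%:R * (u1.2 - v2.2) <= p%:R * (v2.1 - u1.1) by lra.
  have j2 : p'%:R * (v2.1 - u1.1) <= q'%:R * (u1.2 - v2.2) by lra.
  rewrite -(ler_pM2r D0).
  have k1 : p'%:R * (q%:R * (u1.2 - v2.2)) <= p'%:R * (p%:R * (v2.1 - u1.1)).
    by rewrite ler_pM2l.
  have k2 : p%:R * (p'%:R * (v2.1 - u1.1)) <= p%:R * (q'%:R * (u1.2 - v2.2)).
    by rewrite ler_pM2l.
  lra.
move: le; rewrite -!natrM ler_nat leq_eqVlt => /orP[/eqP c|//].
case: ne.
have pp : p' = p.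
  apply/eqP; rewrite eqn_dvd; apply/andP; split.
    by rewrite -(@Gauss_dvdl p' p q') // -c dvdn_mulr.
  by rewrite -(@Gauss_dvdl p p' q) // c dvdn_mulr.
subst p'; have qq : q' = q by nia.
subst q'; congr (_, _, _); apply/eqP; rewrite -(eqr_nat R) eq_le; apply/andP; split.
  by rewrite -ev2.
by rewrite -eu1.
Qed.

(** A list strictly sorted by slope is determined by its members. *)
Lemma compact_edgesE S a b cs a' b' D p0 q0 es :
  newton_path S a b cs a' b' D -> supports S p0 q0 a b ->
  (forall p q N, compact_edge R S p q N -> (p * q0 < p0 * q)%N) ->
  compact_edges R S es -> es = cs.
Proof.
move=> P sup before E; have [_ mem _] := E.
apply: (@irr_sorted_eq _ steeper).
- by move=> e2 e1 e3 /= h12 h23; apply: lt_trans h23 h12.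
- by move=> e; rewrite /steeper ltxx.
- exact: compact_edges_sorted E.
- exact: newton_path_sorted P.
move=> [[p q] N]; apply/idP/idP => [/mem c|/(newton_path_edge P) /mem //].
exact: edge_in_newton_path P sup (before _ _ _ c) c.
Qed.

End NewtonPolyhedron.

(** * Completion on the axes *)

Section CompletionPath.
Local Open Scope nat_scope.
Local Open Scope classical_set_scope.
Implicit Type S : set (nat * nat).

Lemma newton_path_end_support S a b es a' b' D :
  newton_path S a b es a' b' D -> es <> [::] ->
  exists p q, [/\ 0 < p, 0 < q & supports S p q a' b'].
Proof.
elim=> // {a b es a' b' D} a b p q l es a' b' D p0 q0 l0 _ _ sup _ P IH _.
case: es P IH => [|e es] P IH; last exact: IH.
inversion P; subst; exists p, q; split=> // s /sup; lia.
Qed.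

(** The point [(0, n)] is on or above the line with normal [(p0, q0)] through
    [(a, b)], hence above the lines of the edges to come, which are less steep
    and meet the first line at or to the right of [a > 0]. *)
Lemma newton_path_add_left S n p0 q0 a b es a' b' D :
  newton_path S a b es a' b' D -> 0 < a -> 0 < q0 ->
  supports (S `|` [set (0, n)]) p0 q0 a b ->
  (forall s, S s -> p0 * s.1 + q0 * s.2 = p0 * a + q0 * b -> s.1 <= a) ->
  newton_path (S `|` [set (0, n)]) a b es a' b' D.
Proof.
move=> P; elim: P p0 q0 => {a b es a' b' D} [a b Sab bmin|].
  move=> p0 q0 a0 q0_gt0 sup _; apply: PathEnd; first by left.
  move=> s [/bmin //|->] /=; have := sup (0, n) (or_intror erefl) => /=; nia.
move=> a b p q l es a' b' D p_gt0 q_gt0 l0 cop Sab sup supE P IH p0 q0 a0 q0_gt0.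
move=> sup0 sup0E.
have slope : p * q0 < p0 * q.
  have Sx := newton_path_start P.
  have := sup0 _ (or_introl Sx); have := sup0E _ Sx => /=; nia.
have left : p * a + q * (b + p * l) < q * n.
  have := sup0 (0, n) (or_intror erefl); rewrite /= muln0 add0n => h.
  have h1 : p0 * a <= q0 * (n - (b + p * l)) by nia.
  have h2 : q * (p0 * a) <= q * (q0 * (n - (b + p * l))).
    by rewrite leq_mul2l h1 orbT.
  have h3 : q0 * (p * a) < q0 * (q * (n - (b + p * l))) by nia.
  have h4 : p * a < q * (n - (b + p * l)) by rewrite ltn_pmul2l in h3.
  nia.
apply: PathStep => //.
- by left.
- by move=> s [/sup //|->] /=; rewrite muln0 add0n ltnW.
- by move=> s [/supE //|->] /=; lia.
apply: (IH p q) => //; first by lia.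
- by move=> s [/sup|->] /=; lia.
- by move=> s Ss E; have := supE s Ss; lia.
Qed.

(** The mirror image of the preceding lemma, except that the comparison of
    slopes now starts at the added edge and goes up the path; the part already
    prolonged provides the normal to compare with. *)
Lemma newton_path_add_right S n a b es a' D :
  newton_path S a b es a' 1 D -> a' < n ->
  (forall s, (S `|` [set (n, 0)]) s -> n <= s.1 + (n - a') * s.2) ->
  (forall s, (S `|` [set (n, 0)]) s -> s.1 + (n - a') * s.2 = n ->
     a' <= s.1 <= n) ->
  newton_path (S `|` [set (n, 0)]) a b (rcons es (1, n - a', n)) n 0 (D + n).
Proof.
set S' := S `|` _; have [b' b'E] : exists b', b' = 1 by exists 1.
rewrite -[X in newton_path _ _ _ _ _ X]b'E => P.
elim: P b'E => {a b es a' b' D} [a b Sab bmin|].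
  move=> b1 an sup supE; subst b.
  have nE : 1 * a + (n - a) * (0 + 1 * 1) = n by lia.
  have := @PathStep S' a 0 1 (n - a) 1 [::] n 0 0.
  rewrite !nE [1 * n]mul1n addn0; apply=> //.
  - by lia.
  - by rewrite /coprime gcd1n.
  - by left.
  - by move=> s /sup; lia.
  - by move=> s Ss; rewrite mul1n => E; have := supE s Ss; lia.
  have -> : a + (n - a) * 1 = n by lia.
  by apply: PathEnd; [right | move=> s _].
move=> a b p q l es a' b' D p0 q0 l0 cop Sab sup supE P IH b'E an sup' supE'.
have {IH} := IH b'E an sup' supE'.
case Erc: (rcons es _) => [|[[p1 q1] N1] es1] P'; first by case: es Erc {P P'}.
have b_gt0 : 0 < b.
  have [_ /(_ _ (newton_path_start P))] := newton_path_end P; rewrite b'E //.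
have [l1 [b1 [D1 [_ [p1_gt0 q1_gt0 _ _] sup1 sup1E _]]]] := newton_path_cons P'.
have slope : p1 * q < p * q1.
  have Sab' : S' (a, b + p * l) by left.
  have := sup1 _ Sab'; have := sup1E _ Sab'; rewrite /=; nia.
have right : p * a + q * (b + p * l) < p * n.
  have := sup1 (n, 0) (or_intror erefl); rewrite /= muln0 addn0 => h.
  have h1 : q1 * b <= p1 * (n - (a + q * l)) by nia.
  have h2 : p * (q1 * b) <= p * (p1 * (n - (a + q * l))).
    by rewrite leq_mul2l h1 orbT.
  have h3 : p1 * (q * b) < p1 * (p * (n - (a + q * l))) by nia.
  have h4 : q * b < p * (n - (a + q * l)) by rewrite ltn_pmul2l in h3.
  nia.
rewrite rcons_cons Erc -addnA; apply: PathStep => //.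
- by left.
- by move=> s [/sup //|->] /=; rewrite muln0 addn0 ltnW.
- by move=> s [/supE //|->] /=; lia.
Qed.

End CompletionPath.

Section Completion.
Local Open Scope classical_set_scope.
Variable R : realType.
Implicit Type S : set (nat * nat).
Local Notation polyhedron := (@newton_polyhedron R).

(** Both ends of a segment through [(a, b)] lie on the two supporting lines,
    which meet in one point. *)
Lemma newton_vertex_supports S a b p0 q0 p1 q1 :
  S (a, b) -> supports S p0 q0 a b -> supports S p1 q1 a b ->
  (p1 * q0 < p0 * q1)%N -> newton_vertex S (a%:R : R, b%:R : R).
Proof.
move=> Sab sup0 sup1 d; split; first exact: polyhedron_point.
have {}d : p1%:R * q0%:R < p0%:R * q1%:R :> R by rewrite -!natrM ltr_nat.
have zero (u v t : R) : 0 < t < 1 -> 0 <= u -> 0 <= v ->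
    t * u + (1 - t) * v = 0 -> u = v.
  move=> /andP[t0 t1] u0 v0 uv; have t1' : 0 < 1 - t by rewrite subr_gt0.
  have tu : 0 <= t * u by rewrite pmulr_rge0.
  have tv : 0 <= (1 - t) * v by rewrite pmulr_rge0.
  have /eqP : t * u = 0 by lra.
  have /eqP : (1 - t) * v = 0 by lra.
  by rewrite !mulf_eq0 (gt_eqF t0) (gt_eqF t1') /= => /eqP-> /eqP->.
have solve (p q p' q' x y x' y' : R) : p' * q < p * q' ->
    p * x + q * y = p * x' + q * y' -> p' * x + q' * y = p' * x' + q' * y' ->
    x = x' /\ y = y'.
  move=> lt e e'.
  have D0 : p * q' - p' * q != 0 by rewrite lt0r_neq0 // subr_gt0.
  split; apply: (mulfI D0).
    transitivity (q' * (p * x + q * y) - q * (p' * x + q' * y)); first by ring.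
    by rewrite e e'; ring.
  transitivity (p * (p' * x + q' * y) - p' * (p * x + q * y)); first by ring.
  by rewrite e e'; ring.
move=> z1 z2 t P P' t01 az.
have ax : a%:R = t * z1.1 + (1 - t) * z2.1 :> R.
  by have -> : a%:R = ((a%:R, b%:R) : R^o * R^o).1 :> R by []; rewrite az.
have bx : b%:R = t * z1.2 + (1 - t) * z2.2 :> R.
  by have -> : b%:R = ((a%:R, b%:R) : R^o * R^o).2 :> R by []; rewrite az.
have balance p q : supports S p q a b ->
    p%:R * z1.1 + q%:R * z1.2 = p%:R * z2.1 + q%:R * z2.2 :> R.
  move=> sup; have h := supports_polyhedron sup P.
  have h' := supports_polyhedron sup P'.
  have := zero _ _ t t01 h h'; rewrite ax bx => e.
  by have := e ltac:(ring); lra.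
have := solve _ _ _ _ _ _ _ _ d (balance _ _ sup0) (balance _ _ sup1).
by case: z1 z2 {P P' az ax bx balance} => [x y] [x' y'] /= [-> ->].
Qed.

Lemma newton_vertex_extreme S (x y x1 y1 x2 y2 t : R) :
  newton_vertex S (x, y) -> polyhedron S (x1, y1) -> polyhedron S (x2, y2) ->
  0 < t < 1 -> x = t * x1 + (1 - t) * x2 -> y = t * y1 + (1 - t) * y2 ->
  x1 = x2 /\ y1 = y2.
Proof.
move=> [_ ext] P1 P2 t01 xE yE.
have e : (x, y) =
    t *: ((x1, y1) : R^o * R^o) + (1 - t) *: ((x2, y2) : R^o * R^o).
  by rewrite xE yE.
by have [-> ->] := ext _ _ t P1 P2 t01 e.
Qed.

(** When the polygon misses the y-axis, its first vertex is [(1, b)]. As this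
    remains a vertex, no point of [S] to the right of it lies on or below the
    line through [(0, n)] and [(1, b)]: otherwise [(1, b)] would be inside a
    segment of the new polyhedron. So this line carries the new first edge, for
    which [l = 1] and [N = n]. *)
Lemma complete_y_path S S' (i : bool) b es a' b' D :
  newton_path S i b es a' b' D -> es <> [::] ->
  (forall s, S s -> (i <= s.1)%N /\ (s.1 = i :> nat -> b <= s.2)%N) ->
  complete_y R S S' ->
  exists n es', [/\ newton_path S' 0 n es' a' b' (D + i * n)%N, es' <> [::] &
    i = false -> n = b].
Proof.
move=> P es0 left; case: i P left => P left [[my ->]|[nmy [n [-> vs]]]].
- exfalso; case: my => t Pt.
  have S1 s : S s -> (1 <= 1 * s.1 + 0 * s.2)%N by move=> /left[]; lia.
  by have := polyhedron_support S1 Pt; rewrite /= mulr0 mul0r addr0 ler10.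
- case: es P es0 => // -[[p q] N] es P _.
  have [l [b1 [D1 [_ [p0 q0 l0 _] sup _ _]]]] := newton_path_cons P.
  have S1b := newton_path_start P.
  have vtx : newton_vertex (S `|` [set (0, n)%N]) ((1%N)%:R : R, b%:R : R).
    apply: vs; apply: (newton_vertex_supports S1b _ sup (p0 := 1) (q0 := 0)).
      by move=> s /left[] /=; lia.
    by rewrite muln0 mul1n.
  have bn : (b < n)%N.
    rewrite ltnNge; apply/negP => nb.
    have n_pt (x : R) : 0 <= x -> polyhedron (S `|` [set (0, n)%N]) (x, b%:R).
      by move=> x0; apply: (@polyhedron_gen _ _ 0 n); [right | | rewrite ler_nat].
    have h : 0 < (1 / 2 : R) < 1 by lra.
    have [||] := newton_vertex_extreme vtx (n_pt 0 (lexx 0))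
      (n_pt 2 (ler0n R 2)) h; lra.
  have far s : S s -> (1 < s.1)%N -> (n < (n - b) * s.1 + s.2)%N.
    case: s => x y Sxy /= x1; rewrite ltnNge; apply/negP => le.
    have x0 : 0 < x%:R :> R by rewrite ltr0n; lia.
    have xi : x%:R^-1 * x%:R = 1 :> R by rewrite mulVf // lt0r_neq0.
    pose t : R := x%:R^-1.
    have t0 : 0 < t by rewrite invr_gt0.
    have t1 : t < 1 by rewrite invf_lt1 // ltr1n.
    (* h is how far (1, b) is above the segment from (0, n) to (x, y). *)
    pose h : R := b%:R - ((1 - t) * n%:R + t * y%:R).
    have h0 : 0 <= h.
      have : n%:R * (x%:R - 1) + y%:R <= b%:R * x%:R :> R.
        have : (n * x + y <= b * x + n)%N by nia.
        rewrite -(ler_nat R) !natrD !natrM; lra.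
      rewrite -(ler_pM2l t0).
      have -> : t * (n%:R * (x%:R - 1) + y%:R) =
        n%:R * (t * x%:R - t) + t * y%:R by ring.
      have -> : t * (b%:R * x%:R) = b%:R * (t * x%:R) by ring.
      rewrite xi /h; lra.
    have P1 : polyhedron (S `|` [set (0, n)%N]) (0, n%:R + h).
      by apply: (@polyhedron_gen _ _ 0 n) => //=; [right | lra].
    have P2 : polyhedron (S `|` [set (0, n)%N]) (x%:R, y%:R + h).
      by apply: (@polyhedron_gen _ _ x y) => //=; [left | lra].
    have [] := newton_vertex_extreme vtx P2 P1 (t := t).
    - by rewrite t0.
    - by rewrite xi mulr0 addr0.
    - by rewrite /h; ring.
    - by move=> x00; rewrite x00 ltxx in x0.
  have sup1 : supports (S `|` [set (0, n)%N]) (n - b) 1 1 b.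
    move=> s [Ss|->] /=; last by lia.
    have [l1 l2] := left s Ss.
    case: (ltnP 1 s.1) => s1; first by have := far s Ss s1; lia.
    have s1E : s.1 = 1%N by lia.
    by have := l2 s1E; nia.
  have sup1E s : S s ->
      ((n - b) * s.1 + 1 * s.2 = (n - b) * 1 + 1 * b -> s.1 <= 1)%N.
    by move=> Ss; case: (ltnP 1 s.1) => s1; [have := far s Ss s1; lia | ].
  exists n, ((n - b, 1, n)%N :: (p, q, N) :: es); split=> //.
  have := @PathStep (S `|` [set (0, n)%N]) 0 b (n - b) 1 1 ((p, q, N) :: es) a' b' D.
  have -> : (b + (n - b) * 1 = n)%N by lia.
  have -> : ((n - b) * 0 + 1 * n = n)%N by lia.
  rewrite !mul1n [(D + n)%N]addnC; apply=> //.
  - by lia.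
  - by rewrite coprimen1.
  - by right.
  - by move=> s /sup1; lia.
  - move=> s [Ss|->] //= E; have := sup1E s Ss; lia.
  - exact: newton_path_add_left P _ _ sup1 sup1E.
- by exists b, es; split=> //; rewrite mul0n addn0.
- exfalso; apply: nmy; exists b%:R; exact: polyhedron_point (newton_path_start P).
Qed.

(** As for the y-axis: the last vertex [(a', 1)] remains a vertex, so the line
    through it and [(n, 0)] carries a new last edge with [l = 1], [N = n]. *)
Lemma complete_x_path S S' a b es a' (j : bool) D :
  newton_path S a b es a' j D -> es <> [::] -> complete_x R S S' ->
  exists n es', [/\ newton_path S' a b es' n 0 (D + j * n)%N, es' <> [::] &
    j = false -> n = a'].
Proof.
move=> P es0; have [Se bottom] := newton_path_end P.
case: j P Se bottom => P Se bottom [[mx ->]|[nmx [n [-> vs]]]].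
- exfalso; case: mx => t Pt.
  have S1 s : S s -> (1 <= 0 * s.1 + 1 * s.2)%N by move=> /bottom /=; lia.
  by have := polyhedron_support S1 Pt; rewrite /= mulr0 mul0r addr0 ler10.
- have [p [q [p0 q0 sup]]] := newton_path_end_support P es0.
  have vtx : newton_vertex (S `|` [set (n, 0)%N]) (a'%:R : R, (1%N)%:R : R).
    apply: vs; apply: (newton_vertex_supports Se sup (p1 := 0) (q1 := 1)).
      by move=> s /bottom /=; lia.
    by rewrite muln1.
  have an : (a' < n)%N.
    rewrite ltnNge; apply/negP => na.
    have n_pt (y : R) : 0 <= y -> polyhedron (S `|` [set (n, 0)%N]) (a'%:R, y).
      by move=> y0; apply: (@polyhedron_gen _ _ n 0); [right | rewrite ler_nat | ].
    have h : 0 < (1 / 2 : R) < 1 by lra.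
    have [||] := newton_vertex_extreme vtx (n_pt 0 (lexx 0))
      (n_pt 2 (ler0n R 2)) h; lra.
  have far s : S s -> (1 < s.2)%N -> (n < s.1 + (n - a') * s.2)%N.
    case: s => x y Sxy /= y1; rewrite ltnNge; apply/negP => le.
    have y0 : 0 < y%:R :> R by rewrite ltr0n; lia.
    have yi : y%:R^-1 * y%:R = 1 :> R by rewrite mulVf // lt0r_neq0.
    pose t : R := y%:R^-1.
    have t0 : 0 < t by rewrite invr_gt0.
    have t1 : t < 1 by rewrite invf_lt1 // ltr1n.
    (* h is how far (a', 1) is to the right of the segment from (n, 0) to
       (x, y). *)
    pose h : R := a'%:R - ((1 - t) * n%:R + t * x%:R).
    have h0 : 0 <= h.
      have : n%:R * (y%:R - 1) + x%:R <= a'%:R * y%:R :> R.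
        have : (n * y + x <= a' * y + n)%N by nia.
        rewrite -(ler_nat R) !natrD !natrM; lra.
      rewrite -(ler_pM2l t0).
      have -> : t * (n%:R * (y%:R - 1) + x%:R) =
        n%:R * (t * y%:R - t) + t * x%:R by ring.
      have -> : t * (a'%:R * y%:R) = a'%:R * (t * y%:R) by ring.
      rewrite yi /h; lra.
    have P1 : polyhedron (S `|` [set (n, 0)%N]) (n%:R + h, 0).
      by apply: (@polyhedron_gen _ _ n 0) => //=; [right | lra].
    have P2 : polyhedron (S `|` [set (n, 0)%N]) (x%:R + h, y%:R).
      by apply: (@polyhedron_gen _ _ x y) => //=; [left | lra].
    have [] := newton_vertex_extreme vtx P2 P1 (t := t).
    - by rewrite t0.
    - by rewrite /h; ring.
    - by rewrite yi mulr0 addr0.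
    - by move=> _ y00; rewrite y00 ltxx in y0.
  have low s : S s -> (s.2 <= 1)%N -> s.2 = 1%N /\ (a' <= s.1)%N.
    move=> Ss s2; have s2E : s.2 = 1%N by have := bottom s Ss; lia.
    by split=> //; have := sup s Ss; rewrite s2E; nia.
  exists n, (rcons es (1, n - a', n)%N); split=> //; last by case: (es).
  rewrite mul1n; apply: (newton_path_add_right P an) => s [Ss|->] /=.
  + by case: (ltnP 1 s.2) => s2; [have := far s Ss s2 | have := low s Ss s2]; nia.
  + by lia.
  + by case: (ltnP 1 s.2) => s2; [have := far s Ss s2 | have := low s Ss s2]; nia.
  + by lia.
- by exists a', es; split=> //; rewrite mul0n addn0.
- exfalso; apply: nmx; exists a'%:R; exact: polyhedron_point Se.
Qed.

Lemma x_traceE S a b es n D (t : R) :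
  newton_path S a b es n 0 D -> es <> [::] -> x_trace S t -> t = n%:R.
Proof.
move=> P es0 [Pt tmin]; have [Sn _] := newton_path_end P.
have [p [q [p0 _ sup]]] := newton_path_end_support P es0.
apply/eqP; rewrite eq_le; apply/andP; split.
  by apply: tmin; exact: polyhedron_point Sn.
have := supports_polyhedron sup Pt.
by rewrite /= subrr mulr0 addr0 pmulr_rge0 ?ltr0n // subr_ge0.
Qed.

Lemma y_traceE S n es a' b' D (t : R) :
  newton_path S 0 n es a' b' D -> es <> [::] -> y_trace S t -> t = n%:R.
Proof.
move=> P es0 [Pt tmin]; have Sn := newton_path_start P.
case: es P es0 => // -[[p q] N] es P _.
have [l [b1 [D1 [_ [_ q0 _ _] sup _ _]]]] := newton_path_cons P.
apply/eqP; rewrite eq_le; apply/andP; split.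
  by apply: tmin; exact: polyhedron_point Sn.
have := supports_polyhedron sup Pt.
by rewrite /= subrr mulr0 add0r pmulr_rge0 ?ltr0n // subr_ge0.
Qed.

End Completion.

(** * Areas *)

Section Area.
Local Open Scope classical_set_scope.
Variable R : realType.
Implicit Type S : set (nat * nat).
Local Notation polyhedron := (@newton_polyhedron R).
Local Notation area := ((@lebesgue_measure R) \x (@lebesgue_measure R))%E.

Definition trapezoid (a b c m : R) : set (R * R) :=
  [set z | [/\ a <= z.1, z.1 < b, 0 <= z.2 & z.2 < c - m * z.1]].

Lemma measurable_trapezoid a b c m : measurable (trapezoid a b c m).
Proof.
have m1 : measurable_fun setT (fst : R * R -> R) by exact: measurable_fst.
have m2 : measurable_fun setT (snd : R * R -> R) by exact: measurable_snd.
have half (f g : R * R -> R) : measurable_fun setT f -> measurable_fun setT g ->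
    measurable [set z | f z < g z].
  move=> mf mg; have := @measurable_fun_ltr _ _ R setT f g mf mg measurableT [set true] I.
  by rewrite setTI; congr measurable; apply/seteqP; split=> z //=.
have cst (r : R) : measurable_fun setT (fun _ : R * R => r) by exact: measurable_cst.
have -> : trapezoid a b c m = ~` [set z | z.1 < a] `&` [set z | z.1 < b] `&`
    ~` [set z | z.2 < 0] `&` [set z | z.2 < c - m * z.1].
  apply/seteqP; split=> z /=.
    case=> h1 h2 h3 h4; split=> //.
    by split; [split=> // |]; apply/negP; rewrite -leNgt.
  by case=> [[[/negP h1 h2] /negP h3] h4]; split; rewrite // leNgt.
apply: measurableI; last first.
  apply: half => //; apply: measurable_funB => //; exact: measurable_funM.
apply: measurableI; last by apply: measurableC; exact: half.
apply: measurableI; last exact: half.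
by apply: measurableC; exact: half.
Qed.

Lemma area_trapezoid (a b c m : R) : a < b ->
  (forall x, a <= x < b -> 0 <= c - m * x) ->
  area (trapezoid a b c m) =
    ((b - a) * (c - m * a + (c - m * b)) / 2)%:E.
Proof.
move=> ab ge0.
have -> : area (trapezoid a b c m) =
    (\int[lebesgue_measure]_x lebesgue_measure (xsection (trapezoid a b c m) x))%E.
  by [].
(* A primitive of the height of the vertical sections. *)
pose p : {poly R} := c *: 'X - (m / 2) *: 'X^2.
pose g x := (p^`()).[x].
have gE x : g x = c - m * x.
  rewrite /g /p derivB !derivZ derivX derivXn /= !hornerE /=; lra.
transitivity (\int[lebesgue_measure]_(x in `[a, b[) (g x)%:E)%E.
  rewrite [RHS]integral_mkcond; apply: eq_integral => x _.
  rewrite patchE mem_setE in_itv /=; case: ifPn => xab.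
    have -> : xsection (trapezoid a b c m) x = `[0, c - m * x[.
      apply/seteqP; split=> y /=; rewrite /xsection /= inE /trapezoid /= in_itv /=.
        by case=> _ _ -> ->.
      by case/andP=> h1 h2; case/andP: xab.
    rewrite lebesgue_measure_itv /= lte_fin gE.
    case: ltP => h; first by rewrite oppr0 adde0.
    by congr _%:E; apply/eqP; rewrite eq_le h ge0.
  have -> : xsection (trapezoid a b c m) x = set0; last exact: measure0.
  apply/seteqP; split=> y //=; rewrite /xsection /= inE /trapezoid /= => -[h1 h2 _ _].
  by move: xab; rewrite h1 h2.
have cg : continuous g by apply: continuous_horner.
rewrite integral_itv_bndo_bndc; last first.
  by apply/measurable_EFinP; apply: measurable_funTS; exact: continuous_measurable_fun.
rewrite (@continuous_FTC2 R g (horner p)) //.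
- rewrite -EFinB; congr _%:E; rewrite /p !hornerE /=; by field.
- by apply: continuous_subspaceT.
- split.
  + by move=> x _; apply: derivable_horner.
  + by apply: cvg_at_right_filter; exact: continuous_horner.
  + by apply: cvg_at_left_filter; exact: continuous_horner.
- by move=> x _; rewrite -derivE.
Qed.

Lemma polyhedron_above_edge S (p q l a b : nat) (z : R^o * R^o) :
  (0 < q)%N -> (0 < l)%N -> S (a, b + p * l)%N -> S (a + q * l, b)%N ->
  a%:R <= z.1 <= (a + q * l)%:R ->
  (p * a + q * (b + p * l))%:R <= p%:R * z.1 + q%:R * z.2 -> polyhedron S z.
Proof.
case: z => x y q0 l0 S1 S2 /= /andP[ax xb] h.
have Q0 : (0 : R) < q%:R by rewrite ltr0n.
have L0 : (0 : R) < l%:R by rewrite ltr0n.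
(* The point of the edge below z has parameter t; e is the height of z over it.
   Lifting both ends of the edge by e puts z on a segment. *)
pose t : R := (a%:R + q%:R * l%:R - x) / (q%:R * l%:R).
have tE : t * (q%:R * l%:R) = a%:R + q%:R * l%:R - x.
  by rewrite /t divfK // mulf_neq0 // gt_eqF.
have t01 : 0 <= t <= 1.
  rewrite /t divr_ge0 /=; last 2 first.
  - by rewrite natrD natrM in xb; lra.
  - by rewrite mulr_ge0.
  by rewrite ler_pdivrMr ?mulr_gt0 // mul1r; lra.
pose e : R := y - (b%:R + t * p%:R * l%:R).
have e0 : 0 <= e.
  move: h; rewrite !natrD !natrM !natrD !natrM => h.
  rewrite -(pmulr_rge0 _ Q0) /e.
  have -> : q%:R * (y - (b%:R + t * p%:R * l%:R)) =
     q%:R * y - q%:R * b%:R - p%:R * (t * (q%:R * l%:R)) by ring.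
  by rewrite tE; lra.
have P1 : polyhedron S (a%:R, (b + p * l)%:R + e).
  by apply: polyhedron_gen S1 _ _ => //=; lra.
have P2 : polyhedron S ((a + q * l)%:R, b%:R + e).
  by apply: polyhedron_gen S2 _ _ => //=; lra.
have := polyhedron_segment P1 P2 t01; congr (polyhedron S _).
have -> : x = t * a%:R + (1 - t) * (a + q * l)%:R.
  rewrite natrD natrM.
  have -> : t * a%:R + (1 - t) * (a%:R + q%:R * l%:R) = 
    a%:R + q%:R * l%:R - t * (q%:R * l%:R) :> R by ring.
  by rewrite tE; lra.
have -> : y = t * ((b + p * l)%:R + e) + (1 - t) * (b%:R + e).
  by rewrite /e natrD natrM; ring.
by [].
Qed.

(** The first edge closes a trapezoid above the x-axis, and what is left is the
    region of the remaining path. Measurability is proved along the way because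
    additivity of the measure needs it. *)
Lemma newton_region S a b es a' D : newton_path S a b es a' 0 D ->
  let T := [set z : R * R | [/\ a%:R <= z.1, 0 <= z.2 & ~ polyhedron S z]] in
  measurable T /\ area T = ((D%:R - a%:R * b%:R) / 2)%:E.
Proof.
have [b' b'E] : exists b', b' = 0%N by exists 0%N.
rewrite -[X in newton_path _ _ _ _ _ X]b'E => P.
elim: P b'E => {a b es a' b' D} [a b Sab _ b0 T|].
  have -> : T = set0.
    apply/seteqP; split=> z //= -[az z0 nP]; apply: nP.
    by apply: polyhedron_gen Sab az _; rewrite b0.
  by split=> //; rewrite measure0 b0 mulr0 subrr mul0r.
move=> a b p q l es a' b' D p0 q0 l0 _ Sab sup _ P IH b'E T.
have [{IH}] := IH b'E; set T' := [set z | _] => mT' areaT'.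
set N := (p * a + q * (b + p * l))%N in sup *.
pose c : R := N%:R / q%:R; pose m : R := p%:R / q%:R.
have Q0 : (0 : R) < q%:R by rewrite ltr0n.
have L0 : (0 : R) < l%:R by rewrite ltr0n.
have cm x y : (y < c - m * x) = (p%:R * x + q%:R * y < N%:R).
  have -> : c - m * x = (N%:R - p%:R * x) / q%:R.
    by rewrite /c /m; field; rewrite gt_eqF.
  by rewrite ltr_pdivlMr // ltrBrDl [y * _]mulrC.
have aq : a%:R <= (a + q * l)%:R :> R by rewrite ler_nat leq_addr.
have TE : T = trapezoid a%:R (a + q * l)%:R c m `|` T'.
  apply/seteqP; split=> -[x y]; rewrite /T /T' /trapezoid /=.
    case=> ax y0 nP; case: (ltP x (a + q * l)%:R) => xb; last by right.
    left; split=> //; rewrite cm ltNge; apply/negP => h; apply: nP.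
    apply: (polyhedron_above_edge q0 l0 Sab (newton_path_start P)) => //=.
    by rewrite ax ltW.
  case=> [[ax xb y0]|[ax y0 nP]]; last by split=> //; apply: le_trans ax.
  rewrite cm => h; split=> // /(polyhedron_support sup) /=.
  by rewrite leNgt h.
have mtrap := measurable_trapezoid a%:R (a + q * l)%:R c m.
split; first by rewrite TE; exact: measurableU.
have c1 : c - m * a%:R = (b + p * l)%:R.
  by rewrite /c /m /N !natrD !natrM !natrD !natrM; field; rewrite gt_eqF.
have c2 : c - m * (a + q * l)%:R = b%:R.
  by rewrite /c /m /N !natrD !natrM !natrD !natrM; field; rewrite gt_eqF.
rewrite TE measureU //; last first.
  apply/seteqP; split=> -[x y] //=; rewrite /trapezoid /T' /=.
  move=> -[[_ xb _ _] [ax _ _]].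
  by rewrite leNgt xb in ax.
have ab : a%:R < (a + q * l)%:R :> R by rewrite ltr_nat; lia.
have ge0 x : a%:R <= x < (a + q * l)%:R -> 0 <= c - m * x.
  move=> /andP[_ xb]; have m0 : 0 <= m by rewrite divr_ge0.
  apply: (@le_trans _ _ (c - m * (a + q * l)%:R)); first by rewrite c2.
  by rewrite lerB // ler_wpM2l // ltW.
rewrite [X in (X + _)%E](area_trapezoid ab ge0) [X in (_ + X)%E]areaT'.
rewrite c1 c2 -EFinD; congr _%:E.
by rewrite /N !natrD !natrM !natrD !natrM; field.
Qed.

Lemma newton_area_path S a b es a' D : newton_path S a b es a' 0 D ->
  newton_area R S a = ((D%:R - a%:R * b%:R) / 2)%:E.
Proof. by move=> /newton_region[]. Qed.

End Area.

(** * Series, face polynomials and Hamburger-Noether transforms *)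

Section Monomials.
Variable K : fieldType.
Implicit Types f g h : fps2 K.

Lemma psmul_mon i j g a b :
  psmul (psmon K i j) g a b =
  if (i <= a)%N && (j <= b)%N then g (a - i)%N (b - j)%N else 0.
Proof.
rewrite /psmul /psmon; case: (leqP i a) => ia /=; last first.
  rewrite big1 // => k _; rewrite big1 // => l _.
  by rewrite (_ : (k == i :> nat) = false) ?mul0r //; have := ltn_ord k; lia.
rewrite (bigD1 (Ordinal (ia : i < a.+1)%N)) //= [X in _ + X]big1 ?addr0; last first.
  move=> k /negPf ki; rewrite big1 // => l _.
  by rewrite -val_eqE /= in ki; rewrite ki mul0r.
rewrite eqxx; case: (leqP j b) => jb; last first.
  rewrite big1 // => l _.
  by rewrite (_ : (l == j :> nat) = false) ?mul0r //; have := ltn_ord l; lia.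
rewrite (bigD1 (Ordinal (jb : j < b.+1)%N)) //= big1 ?addr0; last first.
  by move=> k /negPf ki; rewrite -val_eqE /= in ki; rewrite ki mul0r.
by rewrite eqxx mul1r.
Qed.

Lemma psdvd_monP i j f :
  psdvd (psmon K i j) f <->
  forall s, exponents f s -> (i <= s.1)%N /\ (j <= s.2)%N.
Proof.
split=> [[h fE] [a b]|sub].
  by rewrite /exponents /= fE psmul_mon; case: andP => // _ /eqP.
exists (fun a b => f (a + i)%N (b + j)%N) => a b; rewrite psmul_mon.
case: ifPn => [/andP[ia jb]|]; first by rewrite !subnK.
apply: contraNeq => fab; apply/andP; exact: sub (a, b) fab.
Qed.

Lemma xmultP f i : xmult f i ->
  (forall s, exponents f s -> (i <= s.1)%N) /\ exists b, exponents f (i, b).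
Proof.
case=> /psdvd_monP dv ndv; split=> [s /dv[]//|]; apply: contrapT => no; apply: ndv.
apply/psdvd_monP => -[a b] fab; split=> //; have [/= ia _] := dv _ fab.
by rewrite ltn_neqAle ia andbT; apply: contra_notN no => /eqP ->; exists b.
Qed.

Lemma ymultP f j : ymult f j ->
  (forall s, exponents f s -> (j <= s.2)%N) /\ exists a, exponents f (a, j).
Proof.
case=> /psdvd_monP dv ndv; split=> [s /dv[]//|]; apply: contrapT => no; apply: ndv.
apply/psdvd_monP => -[a b] fab; split=> //; have [_ /= ia] := dv _ fab.
by rewrite ltn_neqAle ia andbT; apply: contra_notN no => /eqP ->; exists a.
Qed.

Lemma ymult_mulX N h j : ymult h j ->
  (forall s, exponents (psmul (psmon K N 0) h) s -> (j <= s.2)%N) /\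
  exists a, exponents (psmul (psmon K N 0) h) (a, j).
Proof.
move=> /ymultP[hj [a ha]]; split.
  move=> [x y]; rewrite /exponents /= psmul_mon subn0; case: ifP => [_|_ /eqP //].
  exact: (hj (_, y)).
exists (a + N)%N; rewrite /exponents /= psmul_mon subn0 leq_addl addnK; exact: ha.
Qed.

End Monomials.

Section FacePolynomial.
Variable K : fieldType.
Implicit Types f g h : fps2 K.

Definition face_factor (p q : nat) (mu : K) : {poly {poly K}} :=
  'X^q - mu%:P%:P * 'X%:P ^+ p.

Definition face_poly (c : K) (n m p q : nat) (ms : seq (K * nat)) :
    {poly {poly K}} :=
  c%:P%:P * 'X^n * 'X%:P ^+ m * \prod_(r <- ms) face_factor p q r.1 ^+ r.2.

Lemma face_factorE p q mu : face_factor p q mu = 'X^q - (mu *: 'X^p)%:P.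
Proof. by rewrite /face_factor -polyC_exp -polyCM mul_polyC. Qed.

Lemma face_factor_monic p q mu : (0 < q)%N -> face_factor p q mu \is monic.
Proof. by move=> q0; rewrite face_factorE monicXnsubC. Qed.

Lemma size_face_factor p q mu : (0 < q)%N -> size (face_factor p q mu) = q.+1.
Proof. by move=> q0; rewrite face_factorE size_XnsubC. Qed.

Lemma size_prod_face_factor p q ms : (0 < q)%N ->
  size (\prod_(r <- ms) face_factor p q r.1 ^+ r.2) =
  (q * \sum_(r <- ms) r.2).+1.
Proof.
move=> q0; elim: ms => [|r ms IH]; first by rewrite !big_nil size_poly1 muln0.
have mon s : \prod_(r <- s) face_factor p q r.1 ^+ r.2 \is monic.
  by apply: monic_prod => i _; rewrite monic_exp // face_factor_monic.
rewrite !big_cons size_monicM ?monic_neq0 ?monic_exp ?face_factor_monic //.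
have -> : size (face_factor p q r.1 ^+ r.2) = (q * r.2).+1.
  rewrite -[LHS]prednK ?size_exp ?size_face_factor // size_poly_gt0 expf_neq0 //.
  by rewrite monic_neq0 // face_factor_monic.
rewrite IH; lia.
Qed.

Lemma face_polyE (c : K) n m p q ms : face_poly c n m p q ms =
  'X^n * ((c *: 'X^m)%:P * \prod_(r <- ms) face_factor p q r.1 ^+ r.2).
Proof. by rewrite /face_poly -polyC_exp -mul_polyC polyCM -!mulrA mulrCA. Qed.

Lemma face_poly_top (c : K) n m p q ms : (0 < q)%N -> c != 0 ->
  size (face_poly c n m p q ms) = (n + q * \sum_(r <- ms) r.2).+1.
Proof.
move=> q0 c0; have cX : c *: 'X^m != 0 :> {poly K}.
  by rewrite scaler_eq0 negb_or c0 expf_neq0 // polyX_eq0.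
rewrite face_polyE mul_polyC mulrC size_mulXn; last first.
  by rewrite -size_poly_eq0 size_scale // size_prod_face_factor.
by rewrite size_scale // size_prod_face_factor // addnS.
Qed.

Lemma face_poly_bottom (c : K) n m p q ms :
  (0 < q)%N -> c != 0 -> (forall r, r \in ms -> r.1 != 0) ->
  (forall a, (a < n)%N -> (face_poly c n m p q ms)`_a = 0) /\
  (face_poly c n m p q ms)`_n != 0.
Proof.
move=> q0 c0 ms0; rewrite face_polyE.
split=> [a an|]; first by rewrite coefXnM an.
rewrite coefXnM ltnn subnn coefCM mulf_neq0 //.
  by rewrite scaler_eq0 negb_or c0 expf_neq0 // polyX_eq0.
rewrite -horner_coef0 horner_prod prodf_seq_neq0; apply/allP => r /ms0 r0 /=.
rewrite horner_exp expf_neq0 // face_factorE !hornerE expr0n.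
by rewrite eqn0Ngt q0 sub0r oppr_eq0 scaler_eq0 negb_or r0 expf_neq0 ?polyX_eq0.
Qed.

(** The degrees in [x] of the face polynomial range from [n] to [n + q * nu],
    where [nu] is the sum of the exponents, whereas the abscissas of the terms of
    [f] on the edge range from [a] to [a + q * l]. *)
Lemma face_roots_length f p q N ms a b l :
  (0 < p)%N -> (0 < q)%N -> face_roots f p q N ms ->
  exponents f (a, b + p * l)%N -> exponents f (a + q * l, b)%N ->
  (p * a + q * (b + p * l) = N)%N ->
  (forall s, exponents f s ->
     (p * s.1 + q * s.2 = N -> a <= s.1 <= a + q * l)%N) ->
  (\sum_(r <- ms) r.2)%N = l.
Proof.
move=> p0 q0 [_ ms0 [c [n [m [c0 /= PE]]]]] S1 S2 Nab range.
pose P := face_poly c n m p q ms.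
have {}PE x y : P`_x`_y = if (p * x + q * y)%N == N then f x y else 0 by exact: PE.
have ms0' r : r \in ms -> r.1 != 0 by case/ms0.
have [bot botn] := face_poly_bottom n m p q0 c0 ms0'.
have top := face_poly_top n m p ms q0 c0.
have mem x : P`_x != 0 -> (a <= x <= a + q * l)%N.
  move=> Px; have [y Pxy] : exists y, P`_x`_y != 0.
    apply: contrapT => no; case/eqP: Px; apply/polyP => y; rewrite coef0.
    by apply/eqP; apply: contra_notT no => h; exists y.
  move: Pxy; rewrite PE; case: ifP => [/eqP e fxy|_]; last by rewrite eqxx.
  exact: (range (x, y) fxy e).
have Pa : P`_a != 0.
  apply/eqP => /polyP /(_ (b + p * l)%N); rewrite PE Nab eqxx coef0.
  by move/eqP; apply/negP.
have Pb : P`_(a + q * l) != 0.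
  apply/eqP => /polyP /(_ b); rewrite PE coef0.
  have -> : (p * (a + q * l) + q * b)%N == N by apply/eqP; lia.
  by move/eqP; apply/negP.
have an : a = n.
  have := mem _ botn; have : (n <= a)%N.
    by rewrite leqNgt; apply/negP => /bot /eqP; apply/negP.
  lia.
have : P`_(n + q * \sum_(r <- ms) r.2) != 0.
  have -> : (n + q * \sum_(r <- ms) r.2 = (size P).-1)%N by rewrite top.
  by rewrite -lead_coefE lead_coef_eq0 -size_poly_eq0 top.
move/mem; have : (a + q * l < size P)%N.
  by rewrite ltnNge; apply: contra Pb => /leq_sizeP/(_ _ (leqnn _)) ->.
rewrite top -an => h1 h2.
have : (q * \sum_(r <- ms) r.2 = q * l)%N by lia.
by move/eqP; rewrite eqn_pmul2l // => /eqP.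
Qed.

(** The value of a polynomial in [x] and [y] at [(U, V)], where [x] is the outer
    variable and [y] the inner one. *)
Definition poly_eval2 (U V : {poly K}) : {poly {poly K}} -> {poly K} :=
  horner_eval U \o map_poly (comp_poly V).

HB.instance Definition _ U V := GRing.RMorphism.copy (poly_eval2 U V)
  (horner_eval U \o map_poly (comp_poly V)).

Lemma poly_eval2E U V (P : {poly {poly K}}) n :
  (size P <= n)%N -> (forall a, (size (P`_a)%R <= n)%N) ->
  poly_eval2 U V P = \sum_(a < n) \sum_(b < n) P`_a`_b *: (U ^+ a * V ^+ b).
Proof.
move=> sP sPa; rewrite /poly_eval2 /= /horner_eval.
rewrite (@horner_coef_wide _ n); last by apply: leq_trans (size_poly _ _) sP.
apply: eq_bigr => a _; rewrite coef_map /= -[RHS]/(\sum_(b < n) _).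
rewrite /comp_poly (@horner_coef_wide _ n); last first.
  by rewrite size_map_polyC.
rewrite mulr_suml; apply: eq_bigr => b _.
by rewrite coef_map /= mul_polyC -scalerAl mulrC.
Qed.

Lemma poly_eval2_face U V c n m p q ms :
  poly_eval2 U V (face_poly c n m p q ms) =
  c%:P * U ^+ n * V ^+ m * \prod_(r <- ms) (U ^+ q - r.1 *: V ^+ p) ^+ r.2.
Proof.
have EX : poly_eval2 U V 'X = U.
  by rewrite /poly_eval2 /= map_polyX /horner_eval hornerX.
have EC d : poly_eval2 U V d%:P = d \Po V.
  by rewrite /poly_eval2 /= map_polyC /horner_eval hornerC.
rewrite /face_poly !rmorphM !rmorphXn /= EX !EC comp_polyC comp_polyX rmorph_prod.
congr (_ * _); apply: eq_bigr => r _.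
rewrite rmorphXn rmorphB rmorphM !rmorphXn /= EX !EC comp_polyC comp_polyX.
by rewrite mul_polyC.
Qed.

(** Put [W = Y + m]. The exponents [u q] and [v p] differ by 1, so one of the
    monomials is [W] times the other, and the remaining factor is [1 - mu' W] or
    [W - mu']. As [m] is the inverse of [mu], resp. [mu], it vanishes at
    [Y = 0] exactly when [mu' = mu]. *)
Lemma hn_factor p q u v mu m : mu != 0 -> hn_params p q mu u v m ->
  exists k (L : K -> {poly K}) e,
    [/\ m != 0, e != 0,
     forall mu', ('X + m%:P) ^+ u ^+ q - mu' *: ('X + m%:P) ^+ v ^+ p =
       ('X + m%:P) ^+ k * L mu',
     L mu = e *: 'X & forall mu', mu' != mu -> (L mu').[0] != 0].
Proof.
move=> mu0 [[pv ->]|[qu ->]].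
  exists (q * u)%N, (fun mu' => 1 - mu' *: ('X + mu^-1%:P)), (- mu); split.
  - by rewrite invr_eq0.
  - by rewrite oppr_eq0.
  - move=> mu'; rewrite -!exprM [(u * q)%N]mulnC [(v * p)%N]mulnC pv addn1 exprS.
    by rewrite mulrBr mulr1 -scalerAr [_ * ('X + _)]mulrC.
  - by rewrite scalerDr scale_polyC mulfV // opprD addrCA subrr addr0 scaleNr.
  - move=> mu' ne; rewrite !hornerE /= subr_eq0 eq_sym.
    apply: contra ne => /eqP e; apply/eqP.
    by rewrite -[mu']mulr1 -(mulVf mu0) mulrA e mul1r.
exists (p * v)%N, (fun mu' => 'X + mu%:P - mu'%:P), 1; split=> //.
- exact: oner_neq0.
- move=> mu'; rewrite -!exprM [(u * q)%N]mulnC [(v * p)%N]mulnC qu addn1 exprS.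
  by rewrite mulrBr [('X + _) * _]mulrC -mul_polyC [_ * mu'%:P]mulrC.
- by rewrite addrK scale1r.
- by move=> mu' ne; rewrite !hornerE /= subr_eq0 eq_sym.
Qed.

(** The terms of [f] on the line [pX + qY = N] are those which are sent to
    [X^N], so [h (0, Y)] is the face polynomial evaluated at the powers [W^u] and
    [W^v] of [W = Y + m]. By [hn_factor] only the root [mu] gives a power of
    [Y], namely [Y^nu]. *)
Lemma hn_order f p q N ms mu nu h :
  (0 < p)%N -> (0 < q)%N -> face_roots f p q N ms -> (mu, nu) \in ms ->
  hn_transform f p q N mu h ->
  h 0%N nu != 0 /\ forall j, (j < nu)%N -> h 0%N j = 0.
Proof.
move=> p0 q0 [ums ms0 [c [n [k [c0 /= PE]]]]] munu [u [v [m [par hE]]]].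
have [/= mu0 nu0] := ms0 _ munu.
pose P := face_poly c n k p q ms.
have {}PE x y : P`_x`_y = if (p * x + q * y)%N == N then f x y else 0 by exact: PE.
pose W : {poly K} := 'X + m%:P.
have coefh j : h 0%N j = (poly_eval2 (W ^+ u) (W ^+ v) P)`_j.
  have := hE N j; rewrite psmul_mon leqnn subnn subn0 /= => <-.
  rewrite (@poly_eval2E _ _ _ N.+1); last 2 first.
  - apply/leq_sizeP => x Nx; apply/polyP => y; rewrite PE coef0; case: eqP => //; nia.
  - by move=> x; apply/leq_sizeP => y Ny; rewrite PE; case: eqP => //; nia.
  rewrite coef_sum; apply: eq_bigr => x _; rewrite coef_sum big_mkcond /=.
  apply: eq_bigr => y _; rewrite PE; case: ifP => _; last by rewrite scale0r coef0.
  by rewrite coefZ -!exprM -exprD.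
have [l [L [e [m0 e0 facE Lmu Lne]]]] := hn_factor mu0 par.
have perm := perm_to_rem munu.
have mu_notin r : r \in rem (mu, nu) ms -> r.1 != mu.
  move=> rin; have := ums; rewrite (perm_uniq (perm_map fst perm)) /= => /andP[+ _].
  by apply: contra => /eqP r1; apply/mapP; exists r.
pose G := c%:P * (W ^+ u) ^+ n * (W ^+ v) ^+ k * (W ^+ l * e%:P) ^+ nu *
   \prod_(r <- rem (mu, nu) ms) (W ^+ l * L r.1) ^+ r.2.
have W0 : W.[0] != 0 by rewrite /W !hornerE.
have evE : poly_eval2 (W ^+ u) (W ^+ v) P = 'X^nu * G.
  rewrite poly_eval2_face (perm_big _ perm) big_cons /= facE Lmu -mul_polyC.
  rewrite [W ^+ l * _]mulrA [(W ^+ l * e%:P * 'X) ^+ nu]exprMn /G.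
  rewrite (eq_bigr (fun r => (W ^+ l * L r.1) ^+ r.2)); last first.
    by move=> r _; rewrite facE.
  by rewrite -!mulrA; move: (\prod_(r <- _) _) => Q; ring.
have G0 : G.[0] != 0.
  rewrite /G hornerM horner_prod mulf_neq0 //.
    rewrite !(hornerM, horner_exp, hornerC) !mulf_neq0 ?expf_neq0 //.
    by rewrite mulf_neq0 ?expf_neq0.
  rewrite prodf_seq_neq0; apply/allP => r /mu_notin r1 /=.
  rewrite horner_exp hornerM horner_exp expf_neq0 // mulf_neq0 ?expf_neq0 //.
  by rewrite Lne.
split=> [|j jnu]; rewrite coefh evE coefXnM ?jnu // ltnn subnn -horner_coef0.
exact: G0.
Qed.

End FacePolynomial.

(** * The sum over the tree *)

Section Tree.
Variables (R : realType) (K : fieldType).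
Implicit Types f g h : fps2 K.

(** The normal [(1, 0)] plays the part of an edge preceding the first one. *)
Lemma newton_path_of_edges (S : set (nat * nat)) a b d es :
  S (a, b) -> (forall s, S s -> (a <= s.1)%N) ->
  (forall s, S s -> s.1 = a -> (b <= s.2)%N) ->
  (forall s, S s -> (d <= s.2)%N) -> (exists x, S (x, d)) ->
  compact_edges R S es -> exists a' D, newton_path S a b es a' d D.
Proof.
move=> Sab left leftE bot [x Sx] E.
have sup : supports S 1 0 a b by move=> s /left; lia.
have supE s : S s -> (1 * s.1 + 0 * s.2 = 1 * a + 0 * b)%N -> (b <= s.2)%N.
  by move=> Ss e; apply: leftE => //; lia.
have [cs [a' [b' [D P]]]] := newton_path_exists (ltn0Sn 0) Sab sup supE.
have -> : es = cs.
  apply: compact_edgesE P sup _ E => p q N [_ q0 _ _ _]; lia.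
exists a', D; suff -> : d = b' by [].
have [/bot /= db' /(_ _ Sx) /= b'd] := newton_path_end P; lia.
Qed.

(** If [j = 1], the added edge increases [2 A] by [n], the abscissa at which the
    completed polygon meets the x-axis; so [n] cancels. *)
Lemma hn_area_formula (S : set (nat * nat)) N nu es a' (j : bool) D (A t : R) :
  newton_path S N nu es a' j D -> es <> [::] -> hn_area S N A t ->
  2 * A - t = D%:R - N%:R * nu%:R + N%:R - (if j then 0 else a'%:R).
Proof.
move=> P es0 [S1 [cx areaE tr]].
have [n [es1 [P1 es10 nE]]] := complete_x_path P es0 cx.
have := x_traceE P1 es10 tr; move: areaE; rewrite (newton_area_path R P1) => -[<-].
by rewrite natrD natrM; case: j nE {P P1} => [_|/(_ erefl) ->] /=; lra.
Qed.

(** An axis which the polygon misses contributes nothing: the added edge and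
    the trace cancel. *)
Lemma first_area_formula (S : set (nat * nat)) (i : bool) b es a' (j : bool) D
    (A x y : R) :
  newton_path S i b es a' j D -> es <> [::] ->
  (forall s, S s -> (i <= s.1)%N /\ (s.1 = i :> nat -> b <= s.2)%N) ->
  first_area S A x y ->
  2 * A - x - y = D%:R - (if i then 0 else b%:R) - (if j then 0 else a'%:R).
Proof.
move=> P es0 left [S1 [S2 [cy cx areaE xE yE]]].
have [n [es1 [P1 es10 nE]]] := complete_y_path P es0 left cy.
have [m [es2 [P2 es20 mE]]] := complete_x_path P1 es10 cx.
have := x_traceE P2 es20 xE; have := y_traceE P2 es20 yE.
move: areaE; rewrite (newton_area_path R P2) => -[<-] -> ->.
rewrite !natrD !natrM; case: i nE {P left P1 P2} => [_|/(_ erefl) ->];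
  by case: j mE => [_|/(_ erefl) ->] /=; lra.
Qed.

Definition tree_sum up t : R :=
  \sum_(x <- nodes up t | in_V_A0 x) node_mult R x * ((valency x)%:R - 2).

Lemma tree_sum_node up l es :
  tree_sum up (Node l es) =
    (let x := (l, up ++ [seq (root_label e.2, e.1.2) | e <- es]) in
     if in_V_A0 x then node_mult R x * ((valency x)%:R - 2) else 0) +
    \sum_(e <- es) tree_sum [:: (l, e.1.1)] e.2.
Proof.
rewrite /tree_sum /= big_cons big_flatten /= big_map.
by case: ifP => _ //; rewrite add0r.
Qed.

(** A relation rather than a function of [L], because areas and traces depend on
    the chosen completions. *)
Definition hn_values (L : seq (nat * fps2 K)) (W : seq R) : Prop :=
  List.Forall2 (fun Nh w => exists A t, w = 2 * A - t /\
    hn_area (exponents (psmul (psmon K Nh.1 0) Nh.2)) Nh.1 A t) L W.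

Lemma hn_values_cat L1 L2 W : hn_values (L1 ++ L2) W ->
  exists W1 W2, [/\ hn_values L1 W1, hn_values L2 W2 & W = W1 ++ W2].
Proof.
by move/List.Forall2_app_inv_l => [W1 [W2 [V1 [V2 ->]]]]; exists W1, W2.
Qed.

Scheme chain_mind := Minimality for chain Sort Prop
  with branches_mind := Minimality for branches Sort Prop.

(** Induction on the construction of the tree, simultaneously for the branches
    [bs] at a vertex. Each branch counts once in the valency of its vertex,
    which is the summand [N * size bs] on the left of [Pb]. A branch with root
    exponent [nu] thus has to account for [N nu]: if [nu = 1] the summand
    does it alone, and otherwise the polygon of the HN-transform starts at
    [(N, nu)], so that its value [2 A - tr] falls short of the sum over its tree
    by [N nu - N]. The arrow at the end of a chain reads its multiplicity off the
    vertex above it, hence the hypothesis on the edge [up] for an empty chain. *)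
Lemma chain_sum g c j es t L : chain R g c j es t L ->
  forall a b a' D W up, newton_path (exponents g) a b es a' j D ->
  hn_values L W ->
  (es = [::] -> j = false ->
     node_mult R (Arrow (Some false), [:: up]) = a%:R) ->
  tree_sum [:: up] t =
    D%:R + \sum_(w <- W) w - (if j then 0 else a'%:R).
Proof.
pose Pc g (c : nat) (j : bool) es t L := forall a b a' D W up,
  newton_path (exponents g) a b es a' j D -> hn_values L W ->
  (es = [::] -> j = false ->
     node_mult R (Arrow (Some false), [:: up]) = a%:R) ->
  tree_sum [:: up] t = D%:R + \sum_(w <- W) w - (if j then 0 else a'%:R).
pose Pb g (p q N : nat) (c : nat) ms
    (bs : seq (option nat * option nat * ntree)) L :=
  forall ms0 W, (0 < p)%N -> (0 < q)%N -> face_roots g p q N ms0 ->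
  {subset ms <= ms0} -> hn_values L W ->
  \sum_(e <- bs) tree_sum [:: (Vertex N, e.1.1)] e.2 + N%:R * (size bs)%:R =
  N%:R * (\sum_(r <- ms) r.2)%N%:R + \sum_(w <- W) w.
apply: (@chain_mind R K Pc Pb) => {g c j es t L}.
- move=> g c j a b a' D W up P V arrow; inversion V.
  have [-> _ ->] := newton_path_nil P.
  rewrite tree_sum_node !big_nil /in_V_A0 /valency /=.
  case: j {P} arrow => arrow; first by rewrite !addr0 subr0.
  by have /= -> := arrow erefl erefl; lra.
- move=> g c j p q N es t L ms bs Lb fr _ IHb _ IHc a b a' D W up P V arrow.
  have [l [b1 [D1 [[bE NE DE] [p0 q0 l0 _] sup supE P1]]]] := newton_path_cons P.
  have [W1 [W2 [V1 V2 ->]]] := hn_values_cat V.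
  have := IHb ms W1 p0 q0 fr (fun x xin => xin) V1.
  have -> : (\sum_(r <- ms) r.2)%N = l.
    apply: (face_roots_length p0 q0 fr _ (newton_path_start P1)).
    - by rewrite -bE; exact: newton_path_start P.
    - by rewrite -bE.
    - by move=> s Ss; rewrite NE; exact: supE.
  move=> brE; have := IHc _ _ _ _ W2 (Vertex N, Some p) P1 V2.
  have arrow1 : es = [::] -> j = false ->
      node_mult R (Arrow (Some false), [:: (Vertex N, Some p)]) =
      (a + q * l)%:R.
    move=> es0 j0; move: P1; rewrite es0 j0 => /newton_path_nil[_ b10 _].
    apply: canLR (mulfK _) _; first by rewrite pnatr_eq0 -lt0n.
    by rewrite -natrM NE bE -b10; congr _%:R; lia.
  move=> /(_ arrow1) tE; rewrite tree_sum_node /in_V_A0 /valency /= big_cons /= tE.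
  rewrite big_cat /= DE natrD natrM size_map -[(size bs).+2]addn2 natrD; lra.
- by move=> g p q N c ms0 W p0 q0 fr sub V; inversion V; rewrite !big_nil !mulr0.
- move=> g p q N c mu ms bs L _ IH ms0 W p0 q0 fr sub V.
  have := IH ms0 W p0 q0 fr (fun x xin => sub x (mem_behead (s := _ :: _) xin)) V.
  rewrite !big_cons /= tree_sum_node big_nil /= natrD -[(size bs).+1]addn1 natrD; lra.
move=> g p q N c mu nu ms bs L h j es t Lh nu1 hn E es0 ym ch IHc _ IHb.
move=> ms0 W p0 q0 fr sub V.
inversion V as [|? w ? W' [A [tr [wE area]]] V']; subst.
have [W1 [W2 [V1 V2 ->]]] := hn_values_cat V'.
have munu : (mu, nu) \in ms0 by apply: sub; rewrite inE eqxx.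
have [hnu hlow] := hn_order p0 q0 fr munu hn.
have [bot botE] := ymult_mulX N ym.
have SE x y : exponents (psmul (psmon K N 0) h) (x, y) <->
    (N <= x)%N /\ h (x - N)%N y != 0.
  by rewrite /exponents /= psmul_mon subn0 andbT; case: ifP => _;
    split=> [|[]] //; rewrite eqxx.
have [|||a' [D P]] := @newton_path_of_edges _ N nu j es _ _ _ bot botE E.
- by apply/SE; rewrite leqnn subnn.
- by move=> [x y] /SE[].
- move=> [x y] /SE[/= Nx +] xE; rewrite xE subnn; apply: contraNT; rewrite -ltnNge.
  by move/hlow => ->.
have areaE := hn_area_formula P es0 area.
have := IHc _ _ _ _ W1 (Vertex N, Some 1%N) P V1 (fun e => False_ind _ (es0 e)).
have := IHb ms0 W2 p0 q0 fr (fun x xin => sub x (mem_behead (s := _ :: _) xin)) V2.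
rewrite !big_cons big_cat /= !natrD -[(size bs).+1]addn1 natrD => bE ->.
rewrite areaE; move/(canRL (addrK _)): bE => ->.
have combine (d w1 i n s w2 m u : R) :
  d + w1 - i + (n * s + w2 - n * m) + n * (m + 1) =
  n * (u + s) + (d - n * u + n - i + (w1 + w2)) by ring.
exact: combine.
Qed.

End Tree.

Theorem theorem3p8 (R : realType) (K : closedFieldType) (f : fps2 K)
    (hf0 : f 0%N 0%N = 0)
    (hnonconst : exists i j, (i, j) <> (0%N, 0%N) /\ f i j != 0)
    (hred : psreduced f)
    (hedge : exists p q N, compact_edge R (exponents f) p q N)
    (T : ntree) (L : seq (nat * fps2 K)) (hT : newton_tree R f T L)
    (A0 a b : R) (hA0 : first_area (exponents f) A0 a b)
    (A tr : 'I_(size L) -> R)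
    (hA : forall l : 'I_(size L),
       let: (N, h) := tnth (in_tuple L) l in
       hn_area (exponents (psmul (psmon K N 0) h)) N (A l) (tr l)) :
  - tree_mult R T =
  2 * A0 - a - b + \sum_(l < size L) (2 * A l - tr l).
Proof.
case: hT => i [j [es [t [xm ym [E es0] ch ->]]]].
have [left [b1 Sb1]] := xmultP xm; have [bot botE] := ymultP ym.
have [b0 Sb0 b0min] :=
  nat_prop_min (ex_intro (fun y => exponents f (i : nat, y)) b1 Sb1).
have leftE s : exponents f s -> s.1 = i :> nat -> (b0 <= s.2)%N.
  by case: s => x y Ss /= xE; apply: b0min; rewrite -xE.
have [a' [D P]] := newton_path_of_edges Sb0 left leftE bot botE E.
have area :=
  first_area_formula P es0 (fun s Ss => conj (left s Ss) (leftE s Ss)) hA0.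
pose W := [seq 2 * A l - tr l | l <- enum 'I_(size L)].
have V : hn_values L W.
  rewrite /hn_values -{1}[L](map_tnth_enum (in_tuple L)) /W.
  elim: (enum _) => [|l s IH]; first exact: List.Forall2_nil.
  apply: List.Forall2_cons IH; exists (A l), (tr l); split=> //.
  by have := hA l; case: (tnth _ l).
rewrite /tree_mult opprK -/(tree_sum R [::] _) tree_sum_node big_seq1 /=.
rewrite (chain_sum ch P V) /=; last by move=> e; case: es0.
have -> : \sum_(w <- W) w = \sum_(l < size L) (2 * A l - tr l).
  by rewrite /W big_map big_enum; apply: eq_bigl.
rewrite area.
case: es E P es0 ch => // -[[p q] N] es E P _ ch.
have [l [b2 [D1 [[bE NE _] [p0 q0 _ _] _ _ _]]]] := newton_path_cons P.
have -> : root_label t = Vertex N by inversion ch.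
rewrite /in_V_A0 /valency /=.
case: i P NE {xm left Sb1 Sb0 b0min leftE area} => P NE /=.
  by rewrite subr0 add0r addrAC.
have -> : N%:R / (q + 0 * p)%:R = b0%:R :> R.
  by rewrite NE muln0 add0n mul0n addn0 natrM mulrC mulKf // pnatr_eq0 -lt0n.
have combine (d x y z : R) : x * (1 - 2) + (d + y - z) = d - x - z + y by ring.
exact: combine.
Qed.
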